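(* Consider the Erlang-C system. There exists a constant $C>0$ (independent of $\lambda,n,\mu$) such that for all $\lambda>0$, $\mu>0$ and integers $n\ge1$ satisfying $1/2\le\rho<1$, and for every integer $k>n$, with $z=\delta(k-R)$, $$\begin{aligned}\bigg|\frac{\mathbb{P}(\tilde X(\infty)\ge z)}{\mathbb{P}(Y_S(\infty)\ge z)}-1\bigg|\le{}&\frac{1-\rho}{\rho}+\frac{2(1-\rho)^2}{\rho}+\delta^2+Ce^{\zeta^2}\Big(\delta^2+\delta\frac{1-\rho}{\rho}+\frac{(1-\rho)^2}{\rho^2}\Big)\\&+Ce^{2\zeta^2}\zeta^2\Big(\delta^2+\delta\frac{1-\rho}{\rho}+\frac{(1-\rho)^2}{\rho^2}\Big)\min\Big\{z\vee1,\ \frac1{\delta^2}\Big(\frac1{|\zeta|}+\delta\Big)^3\Big\}.\end{aligned}$$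
   Context: Erlang-C system: $n$ homogeneous servers, Poisson arrivals with rate $\lambda$, i.i.d. exponential service times with mean $1/\mu$, first-come-first-serve, infinite buffer, no abandonment. The customer count $X=\{X(t),t\ge0\}$ is the birth-death process on $\{0,1,2,\dots\}$ with birth rate $\lambda$ in every state and death rate $\mu(k\wedge n)$ in state $k$. Set $R=\lambda/\mu$, $\delta=1/\sqrt R$, $\rho=\lambda/(n\mu)=R/n$, $\zeta=\delta(R-n)$. When $R<n$, $X$ is positive recurrent, $X(\infty)$ denotes a random variable with its stationary distribution, and $\tilde X(\infty)=\delta(X(\infty)-R)$. Define $b(x)=-\mu x$ for $x\le-\zeta$ and $b(x)=\mu\zeta$ for $x\ge-\zeta$; define $a(x)=\mu$ for $x\le-1/\delta$, $a(x)=\mu(2+\delta x)$ for $x\in[-1/\delta,-\zeta]$, and $a(x)=\mu(2+\delta|\zeta|)$ for $x\ge-\zeta$. $Y_S(\infty)$ is a continuous random variable on $\mathbb{R}$ with density $\frac{\kappa}{a(x)}\exp\big(\int_0^x\frac{2b(y)}{a(y)}dy\big)$, $\kappa>0$ the normalizing constant. $x\vee y=\max(x,y)$. *)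

(* Defs.v *)
From HB Require Import structures.
From mathcomp Require Import all_boot all_order all_algebra.
From mathcomp Require Import all_classical all_reals all_analysis.

Set Implicit Arguments.
Unset Strict Implicit.
Unset Printing Implicit Defensive.

Import Order.TTheory GRing.Theory Num.Theory.
Import numFieldNormedType.Exports.

Local Open Scope classical_set_scope.
Local Open Scope ring_scope.

Section ContinuousTimeMarkovChain.
Context {R : realType}.

(* The diagonal entry is minus the total jump rate; for a birth-death chain on
   {0, 1, 2, ...} the death rate in state 0 must be 0. *)
Definition birth_death_rate (birth death : nat -> R) (i j : nat) : R :=
  if j == i.+1 then birth i
  else if i == j.+1 then death i
  else if i == j then - (birth i + death i)
  else 0.

(* Only nonnegative times matter: P t is unconstrained for t < 0. *)
Definition transition_function (q : nat -> nat -> R)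
    (P : R -> R.-pker nat ~> nat) : Prop :=
  [/\ forall i A, P 0 i A = \d_i A,
      forall s t, 0 <= s -> 0 <= t -> forall i A,
        P (s + t) i A = (\int[P s i]_j P t j A)%E
    & forall i j,
        h^-1 * (fine (P h i [set j]) - (i == j)%:R) @[h --> 0^'+] --> q i j].

Definition stationary_distribution (P : R -> R.-pker nat ~> nat)
    (pi : probability nat R) : Prop :=
  forall t, 0 <= t -> forall A, (\int[pi]_i P t i A)%E = pi A.

End ContinuousTimeMarkovChain.

Section ErlangC.
Context {R : realType}.
Variables (lam mu : R) (n : nat).

Definition erlangC_rate : nat -> nat -> R :=
  birth_death_rate (fun=> lam) (fun k => mu * (minn k n)%:R).

Definition offered_load : R := lam / mu.

Definition delta : R := (Num.sqrt offered_load)^-1.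

Definition rho : R := lam / (n%:R * mu).

Definition zeta : R := delta * (offered_load - n%:R).

Definition scaled_count (x : nat) : R := delta * (x%:R - offered_load).

Definition drift (x : R) : R := if x <= - zeta then - mu * x else mu * zeta.

Definition diffusion (x : R) : R :=
  if x <= - delta^-1 then mu
  else if x <= - zeta then mu * (2 + delta * x)
  else mu * (2 + delta * `|zeta|).

End ErlangC.

(* The integral from a to b, with the usual sign change when b < a. *)
Definition oriented_integral {R : realType} (f : R -> R) (a b : R) : R :=
  if a <= b then \int[lebesgue_measure]_(y in `[a, b]) f y
  else - \int[lebesgue_measure]_(y in `[b, a]) f y.

Section DiffusionApproximation.
Context {R : realType}.
Variables (lam mu : R) (n : nat).

Definition unnormalized_density (x : R) : R :=
  (diffusion lam mu n x)^-1 *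
  expR (oriented_integral
          (fun y => 2 * drift lam mu n y / diffusion lam mu n y) 0 x).

Definition kappa : R :=
  (\int[lebesgue_measure]_(x in [set: R]) unnormalized_density x)^-1.

Definition YS_density (x : R) : R := kappa * unnormalized_density x.

End DiffusionApproximation.

Definition has_density {R : realType} (nu : probability R R) (f : R -> R) :
    Prop :=
  forall A : set R, measurable A ->
    nu A = (\int[lebesgue_measure]_(x in A) (f x)%:E)%E.

(* Main.v *)
Require Import Defs.
From HB Require Import structures.
From mathcomp Require Import all_boot all_order all_algebra.
From mathcomp Require Import all_classical all_reals all_analysis.
From mathcomp Require Import measurable_realfun ring lra.

Set Implicit Arguments.
Unset Strict Implicit.
Unset Printing Implicit Defensive.

Import Order.TTheory GRing.Theory Num.Theory.
Import numFieldNormedType.Exports.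

Local Open Scope classical_set_scope.
Local Open Scope ring_scope.

(** Write [a = - zeta], [dl = delta] and [u = dl * a], so that
    [rho = (1 + u)^-1] and [u = (1 - rho) / rho].

    Both tails are known beyond level [n].  Stationarity forces detailed balance
    ([detailed_balance]), hence the masses are geometric with ratio [rho] above
    [n], and
    [P (X >= n + i) = rho ^+ i / (1 + (1 - rho) * S)], where [S] is the sum over
    [k < n] of the masses relative to the mass at [n] ([erlangC_tail]).  The
    density of [Y] is exponential to the right of [a] with rate
    [decay dl a = 2 * a / (2 + u)], so that the tail of [Y] at [a + dl * i] is
    [expR (- (2 * u / (2 + u)) * i) / (1 + 2 * u / (2 + u) * J)], where [dl * J]
    is the integral of the density to the left of [a], divided by the density at
    [a] ([YS_tail]).  Thus [S] and [J] are the discrete and the continuous Mills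
    ratio at [n].

    The quotient of the tails is therefore a product of two factors.  The first
    compares the rates: [ln (1 + u)] and [2 * u / (2 + u)] differ by at most
    [u ^+ 3] ([rate_defect]), which yields the term with the minimum.  The second
    is [(1 + 2 * u / (2 + u) * J) / (1 + (1 - rho) * S)]; if [J] were equal to
    [S + 1 / 2] it would be exactly [1 + u / (2 + u)] ([quotient_error]), which
    explains the term [(1 - rho) / rho].

    The heart of the proof is that, up to factors depending on [a] only,
    [J - S - 1 / 2] is of order [dl] ([mills_ratio_error]), although [J] and [S]
    are of order [1 / dl].  The half
    line to the left of [a] is cut into cells of width [dl] centred at the points
    [grid dl k], [k < n], which leaves half a cell at [a].  On a cell the
    midpoint rule is accurate to relative order [dl ^+ 2] ([density_cell]).  At
    the grid points the density and the masses, both normalized at [n], agree to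
    relative order [dl ^+ 2] ([density_sub_mass]), because the one-step increments
    of their logarithms agree to order [dl ^+ 3] ([log_defect_le]).  Both are
    dominated by a Gaussian in the grid point times [expR (a ^+ 2 / 2)], which
    makes the sum of the errors over the grid of order [dl]. *)


(** * Elementary inequalities *)

Section ElementaryInequalities.
Context {R : realType}.
Implicit Types s t u v w x y : R.

(** The inequality [1 - s / 2 <= expR (- (s / 2))], squared and inverted; the
    coefficient [2] is what makes it reach up to [s = 1]. *)
Lemma expR_le_quadratic s : s <= 1 -> expR s <= 1 + s + 2 * s ^+ 2.
Proof.
move=> s1.
have h : 1 - s / 2 <= expR (- (s / 2)) by have := expR_ge1Dx (- (s / 2)).
have e0 : 0 < expR (- (s / 2)) := expR_gt0 _.
have -> : expR s = (expR (- (s / 2)) ^+ 2)^-1.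
  by rewrite -expRM_natl -expRN; congr expR; field.
have h2 : (1 - s / 2) ^+ 2 <= expR (- (s / 2)) ^+ 2.
  by rewrite ler_pXn2r // ?nnegrE; lra.
have q0 : 0 < (1 - s / 2) ^+ 2 by apply: exprn_gt0; lra.
apply: (@le_trans _ _ ((1 - s / 2) ^+ 2)^-1).
  by rewrite lef_pV2 ?posrE // exprn_gt0.
rewrite -(ler_pM2r q0) mulVf ?gt_eqF //.
have : 0 <= s ^+ 2 * ((s - 1) * (s - 5 / 2)).
  by apply: mulr_ge0; [exact: sqr_ge0|nra].
by nra.
Qed.

Lemma one_sub_expRN_le x : 1 - expR (- x) <= x.
Proof. by have := expR_ge1Dx (- x); lra. Qed.

Lemma is_derive_ln_affine (c y : R) : 0 < 1 + c * y ->
  is_derive y 1 (fun t : R => ln (1 + c * t)) (c / (1 + c * y)).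
Proof.
move=> h.
have H : is_derive y 1 (fun t : R => 1 + c * t) (0 + (c *: 1 + y *: 0)).
  by apply: is_deriveD; apply: is_deriveM.
apply: is_derive_eq.
  exact: (@is_derive1_comp _ _ (fun t : R => 1 + c * t) _ _ _ (is_derive1_ln h) H).
by rewrite scaler0 add0r addr0 [_ *: _]mulr1 mulrC.
Qed.

Lemma ln_ratio_bounds y : 0 <= y <= 1 / 2 ->
  2 * y <= ln ((1 + y) / (1 - y)) <= 2 * y + 2 * y ^+ 3.
Proof.
move=> /andP[y0 y2].
have -> : ln ((1 + y) / (1 - y)) = ln (1 + 1 * y) - ln (1 + (-1) * y).
  by rewrite ln_div ?posrE; [rewrite mul1r mulN1r|lra|lra].
pose f c (t : R) : R := ln (1 + 1 * t) - ln (1 + (-1) * t) - 2 * t - c * t ^+ 3.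
pose df c (t : R) : R := 1 / (1 + 1 * t) - (-1) / (1 + (-1) * t) - 2 - c * (3 * t ^+ 2).
have dfE c t : -1 < t -> t < 1 -> is_derive t 1 (f c) (df c t).
  move=> t0 t1; rewrite /f /df.
  have h1 : is_derive t 1 (fun t : R => ln (1 + 1 * t)) (1 / (1 + 1 * t)).
    by apply: is_derive_ln_affine; lra.
  have h2 : is_derive t 1 (fun t : R => ln (1 + (-1) * t)) ((-1) / (1 + (-1) * t)).
    by apply: is_derive_ln_affine; lra.
  apply: is_derive_eq; rewrite /GRing.scale /=; ring.
have key c : exists2 t, t \in `[0, y]%R & f c y = df c t * y.
  have [||t ty] := @MVT_segment _ (f c) (df c) 0 y y0.
  - by move=> x; rewrite in_itv /= => /andP[x0 x1]; apply: dfE; lra.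
  - apply: derivable_within_continuous => x; rewrite in_itv /= => /andP[x0 x1].
    by apply: (@ex_derive _ _ _ _ _ _ (df c x)); apply: dfE; lra.
  rewrite {2}/f !mulr0 addr0 ln1 subrr expr0n mulr0 !subr0 => e.
  by exists t.
apply/andP; split.
  have [t] := key 0; rewrite in_itv /= => /andP[t0 t1].
  rewrite /f /df !mul0r !subr0 => e.
  have : 0 <= (1 / (1 + 1 * t) - -1 / (1 + -1 * t) - 2) * y.
    apply: mulr_ge0 => //.
    have -> : 1 / (1 + 1 * t) - -1 / (1 + -1 * t) - 2 = 2 * t ^+ 2 / ((1 + t) * (1 - t)).
      by field; apply/andP; split; rewrite gt_eqF //; lra.
    by apply: divr_ge0; nra.
  lra.
have [t] := key 2; rewrite in_itv /= => /andP[t0 t1]; rewrite /f /df => e.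
have : (1 / (1 + 1 * t) - -1 / (1 + -1 * t) - 2 - 2 * (3 * t ^+ 2)) * y <= 0.
  apply: mulr_le0_ge0 => //.
  have -> : 1 / (1 + 1 * t) - -1 / (1 + -1 * t) - 2 = 2 * t ^+ 2 / ((1 + t) * (1 - t)).
    by field; apply/andP; split; rewrite gt_eqF //; lra.
  rewrite subr_le0 ler_pdivrMr; last by apply: mulr_gt0; lra.
  have : 0 <= t ^+ 2 * (4 - 6 * t ^+ 2) by apply: mulr_ge0; [exact: sqr_ge0|nra].
  lra.
lra.
Qed.

(** The logarithm of [x] is read through [y = (x - 1) / (x + 1)], for which
    [x = (1 + y) / (1 - y)]: the expansion of [ln x] is then odd in [y], and
    that removes the quadratic error term.  All estimates of logarithms below
    rest on this reading. *)
Lemma ln_ge1_bounds x : 1 <= x <= 3 ->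
  2 * ((x - 1) / (x + 1)) <= ln x <=
  2 * ((x - 1) / (x + 1)) + 2 * ((x - 1) / (x + 1)) ^+ 3.
Proof.
move=> /andP[x1 x3].
have -> : ln x = ln ((1 + (x - 1) / (x + 1)) / (1 - (x - 1) / (x + 1))).
  congr ln; field; apply/andP; split; rewrite ?gt_eqF //; lra.
apply: ln_ratio_bounds; apply/andP; split; first by apply: divr_ge0; lra.
by rewrite ler_pdivrMr; lra.
Qed.

Lemma ln_le1_bounds x : 1 / 3 <= x <= 1 ->
  2 * ((x - 1) / (x + 1)) + 2 * ((x - 1) / (x + 1)) ^+ 3 <= ln x <=
  2 * ((x - 1) / (x + 1)).
Proof.
move=> /andP[x1 x3].
have xp : 0 < x by lra.
have hx : 1 <= x^-1 <= 3.
  apply/andP; split; first by rewrite -[leLHS]invr1 lef_pV2 ?posrE.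
  by rewrite -[leRHS]invrK lef_pV2 ?posrE //; lra.
have := ln_ge1_bounds hx; rewrite lnV ?posrE //.
have -> : (x^-1 - 1) / (x^-1 + 1) = - ((x - 1) / (x + 1)).
  by field; rewrite !gt_eqF //=; lra.
by set z := (x - 1) / (x + 1); move=> /andP[h1 h2]; apply/andP; split; lra.
Qed.

Lemma ln1D_ge v : - (1 / 2) <= v <= 1 / 2 -> v - v ^+ 2 <= ln (1 + v).
Proof.
move=> /andP[v1 v2].
have [v0|v0] := leP 0 v.
  have /andP[+ _] : 2 * ((1 + v - 1) / (1 + v + 1)) <= ln (1 + v) <= 
    2 * ((1 + v - 1) / (1 + v + 1)) + 2 * ((1 + v - 1) / (1 + v + 1)) ^+ 3.
    by apply: ln_ge1_bounds; lra.
  apply: le_trans.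
  have -> : 2 * ((1 + v - 1) / (1 + v + 1)) = (2 * v) / (2 + v) by field; lra.
  rewrite ler_pdivlMr; nra.
have hv : 1 / 3 <= 1 + v <= 1 by apply/andP; split; lra.
have /andP[+ _] := ln_le1_bounds hv.
apply: le_trans.
have -> : 2 * ((1 + v - 1) / (1 + v + 1)) + 2 * ((1 + v - 1) / (1 + v + 1)) ^+ 3
   = (2 * v * (2 + v) ^+ 2 + 2 * v ^+ 3) / (2 + v) ^+ 3 by field; lra.
rewrite ler_pdivlMr; last by apply: exprn_gt0; lra.
have : 0 <= v ^+ 2 * ((1 / 2 + v) * (v ^+ 2 + 9 / 2 * v + 31 / 4) + 1 / 8).
  apply: mulr_ge0; first exact: sqr_ge0.
  by apply: addr_ge0; [apply: mulr_ge0; nra|lra].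
lra.
Qed.

End ElementaryInequalities.


(** * Stationary distributions of birth-death chains *)

Section StationaryBirthDeath.
Context {R : realType}.
Implicit Types (m : probability nat R) (P : R -> R.-pker nat ~> nat).

Lemma integral_nat_ge_sum m (f : nat -> \bar R) (s : seq nat) :
  (forall i, (0 <= f i)%E) -> uniq s ->
  (\sum_(i <- s) f i * m [set i] <= \int[m]_i f i)%E.
Proof.
move=> f0 us.
rewrite [leLHS](_ : _ = (\int[m]_(x in \big[setU/set0]_(i <- s) [set i]) f x)%E).
  by apply: ge0_subset_integral => //; apply: bigsetU_measurable.
rewrite ge0_integral_bigsetU //; last first.
  by move=> i j _ _ [x [/= -> ->]].
apply: eq_bigr => i _; rewrite -integral_cst //.
by apply: eq_integral => x; rewrite inE /= => ->.
Qed.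

(** Keeping only finitely many starting states turns stationarity at a small
    time [h] into an inequality that can be divided by [h] and passed to the
    limit without exchanging a limit and an infinite sum. *)
Lemma stationary_rate_le q P m (j : nat) (s : seq nat) :
  transition_function q P -> stationary_distribution P m ->
  uniq s -> j \in s ->
  \sum_(i <- s) fine (m [set i]) * q i j <= 0.
Proof.
move=> [_ _ Pq] st us js.
pose f (h : R) : R := \sum_(i <- s)
  fine (m [set i]) * (h^-1 * (fine (P h i [set j]) - (i == j)%:R)).
have fq : f h @[h --> 0^'+] --> \sum_(i <- s) fine (m [set i]) * q i j.
  apply: (@cvg_big _ _ +%R 0 xpredT); first exact: add_continuous.
  by move=> i _; apply: cvgM; [exact: cvg_cst|exact: Pq].
apply: (cvgr_to_le fq).
near=> h.
have h0 : 0 < h by near: h; exact: nbhs_right_gt.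
rewrite /f.
under eq_bigr => i _ do rewrite mulrCA mulrBr.
rewrite -mulr_sumr pmulr_rle0 ?invr_gt0 // sumrB subr_le0.
rewrite [leRHS](_ : _ = fine (m [set j])); last first.
  rewrite (bigD1_seq j) //= eqxx mulr1 big1 ?addr0 // => i /negbTE ->.
  by rewrite mulr0.
rewrite -lee_fin -sumEFin fineK; last exact: fin_num_measure.
rewrite -(st h (ltW h0) [set j]).
apply: le_trans (@integral_nat_ge_sum m (fun i => P h i [set j]) s _ us) => //.
rewrite le_eqVlt; apply/orP; left; apply/eqP; apply: eq_bigr => i _.
rewrite EFinM muleC; congr (_ * _)%E; rewrite fineK //; last first.
  exact: fin_num_measure.
rewrite ge0_fin_numE // (@le_lt_trans _ _ (P h i [set: nat])) //.
  by apply: le_measure; rewrite ?inE.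
by rewrite prob_kernel ltry.
Unshelve. all: end_near. Qed.

Definition tail m (k : nat) : R := fine (m [set j | (k <= j)%N]).

Lemma tail0 m : tail m 0 = 1.
Proof.
rewrite /tail (_ : [set j | _] = setT) ?probability_setT //.
by apply/seteqP; split.
Qed.

Lemma tailS m k : tail m k = fine (m [set k]) + tail m k.+1.
Proof.
rewrite /tail -fineD; try exact: fin_num_measure.
rewrite -measureU //.
  congr (fine (m _)); apply/seteqP; split => j /=.
    by rewrite leq_eqVlt => /orP[/eqP->|]; [left|right].
  by case=> [->//|/ltnW].
by apply/seteqP; split => // j /= [->]; rewrite ltnn.
Qed.

Lemma cvg_tail m : tail m k @[k --> \oo] --> (0 : R).
Proof.
have h : (m \o (fun k => [set j | (k <= j)%N])) x @[x --> \oo] -->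
    m (\bigcap_k [set j | (k <= j)%N]).
  apply: nonincreasing_cvg_mu => //.
    by rewrite (le_lt_trans (probability_le1 _ _)) // ltry.
  by move=> a b ab; apply/subsetPset => j /=; exact: leq_trans.
have e : \bigcap_k [set j | (k <= j)%N] = set0 :> set nat.
  by apply/seteqP; split => // j /(_ j.+1 I) /=; rewrite ltnn.
rewrite e measure0 in h.
exact: (fine_cvg h).
Qed.

Lemma cvg_point_mass m : fine (m [set k]) @[k --> \oo] --> (0 : R).
Proof.
have -> : (fun k => fine (m [set k])) = (fun k => tail m k - tail m k.+1).
  by apply/funext => k; rewrite (tailS m k) addrK.
rewrite -[X in _ --> X]subr0; apply: cvgB; first exact: cvg_tail.
by rewrite (cvg_shiftS (tail m)); exact: cvg_tail.
Qed.

(** Summing the stationarity inequality [stationary_rate_le] over three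
    neighbouring states says that the probability flux from [j] to [j.+1] is
    nondecreasing in [j].  It starts at a nonnegative value and vanishes at
    infinity because the rates are bounded, so it is zero throughout. *)
Lemma detailed_balance (birth death : nat -> R) P m (M : R) :
  death 0 = 0 -> (forall j, `|birth j| <= M) -> (forall j, `|death j| <= M) ->
  transition_function (birth_death_rate birth death) P ->
  stationary_distribution P m ->
  forall j, birth j * fine (m [set j]) = death j.+1 * fine (m [set j.+1]).
Proof.
move=> d0 bM dM tf st.
pose p j := fine (m [set j]).
pose F j := birth j * p j - death j.+1 * p j.+1.
have F0 : 0 <= F 0%N.
  have := @stationary_rate_le _ _ _ 0%N [:: 0; 1]%N tf st isT isT.
  rewrite !big_cons big_nil /birth_death_rate /= d0 -/(p 0%N) -/(p 1%N) /F.
  lra.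
have FS j : F j <= F j.+1.
  have us : uniq [:: j; j.+1; j.+2].
    by rewrite /= !inE !eqSS; do ! rewrite ltn_eqF //.
  have := @stationary_rate_le _ _ _ j.+1 _ tf st us.
  rewrite !inE eqxx orbT => /(_ isT).
  rewrite !big_cons big_nil /birth_death_rate !eqxx !eqSS.
  have e1 : (j == j.+1) = false by rewrite ltn_eqF.
  have e2 : (j == j.+2) = false by rewrite ltn_eqF.
  rewrite e1 e2 -/(p j) -/(p j.+1) -/(p j.+2) /F; lra.
have Fmono i j : (i <= j)%N -> F i <= F j.
  by apply: (homo_leq (r := <=%R)) => //; exact: le_trans.
have M0 : 0 <= M by apply: le_trans (bM 0%N).
have F_le j : F j <= M * p j + M * p j.+1.
  have pj k : 0 <= p k by apply: fine_ge0.
  rewrite /F; apply: lerD.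
    by apply: ler_wpM2r => //; apply: le_trans (bM j); exact: ler_norm.
  rewrite -mulNr; apply: ler_wpM2r => //; apply: le_trans (dM j.+1).
  by rewrite -normrN; exact: ler_norm.
have cF : M * p j + M * p j.+1 @[j --> \oo] --> (0 : R).
  have c1 : M * p j @[j --> \oo] --> (0 : R).
    rewrite -[X in _ --> X](mulr0 M); apply: cvgM; first exact: cvg_cst.
    exact: cvg_point_mass.
  rewrite -[X in _ --> X]addr0; apply: cvgD => //.
  by rewrite (cvg_shiftS (fun j => M * p j)).
move=> j; apply/eqP; rewrite -subr_eq0 -/(p j) -/(p j.+1) -/(F j).
rewrite eq_le; apply/andP; split; last exact: le_trans (Fmono 0%N j _).
have jF : \forall k \near \oo, F j <= M * p k + M * p k.+1.
  near=> k; apply: le_trans (F_le k); apply: Fmono; near: k; exact: nbhs_infty_ge.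
exact: (cvgr_to_ge cF jF).
Unshelve. all: end_near. Qed.

(** Beyond level [n] the masses are geometric with ratio [rho], so
    [(1 - rho) * tail m k - m k] does not depend on [k]; it tends to zero. *)
Lemma geometric_tail m n (rho : R) :
  (forall k, (n <= k)%N -> fine (m [set k.+1]) = rho * fine (m [set k])) ->
  forall k, (n <= k)%N -> (1 - rho) * tail m k = fine (m [set k]).
Proof.
move=> geo k nk.
pose D i := (1 - rho) * tail m (k + i)%N - fine (m [set (k + i)%N]).
have DS i : D i.+1 = D i.
  rewrite /D addnS (tailS m (k + i)) geo; last by rewrite (leq_trans nk) // leq_addr.
  by ring.
have D0 i : D i = D 0%N by elim: i => // i; rewrite DS.
have cD : D i @[i --> \oo] --> (0 : R).
  have c1 : tail m (k + i)%N @[i --> \oo] --> (0 : R).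
    have -> : (fun i => tail m (k + i)%N) = [sequence tail m (i + k)%N]_i.
      by apply/funext => i; rewrite addnC.
    by rewrite (cvg_shiftn k (tail m)); exact: cvg_tail.
  have c2 : fine (m [set (k + i)%N]) @[i --> \oo] --> (0 : R).
    have -> : (fun i => fine (m [set (k + i)%N])) =
        [sequence fine (m [set (i + k)%N])]_i.
      by apply/funext => i; rewrite addnC.
    by rewrite (cvg_shiftn k (fun i => fine (m [set i]))); exact: cvg_point_mass.
  have : D i @[i --> \oo] --> (1 - rho) * 0 - 0.
    by apply: cvgB => //; apply: cvgM => //; exact: cvg_cst.
  by rewrite mulr0 subr0.
have : D 0%N = 0.
  suff c0 : D i @[i --> \oo] --> D 0%N.
    by rewrite -(cvg_lim (@Rhausdorff R) c0) (cvg_lim (@Rhausdorff R) cD).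
  have -> : D = fun=> D 0%N by apply/funext.
  exact: cvg_cst.
by rewrite /D addn0 => /eqP; rewrite subr_eq0 => /eqP.
Qed.

Lemma tail_split m n : \sum_(0 <= k < n) fine (m [set k]) + tail m n = 1.
Proof.
elim: n => [|n IH]; first by rewrite big_geq // add0r tail0.
by rewrite big_nat_recr //= -addrA -tailS.
Qed.

End StationaryBirthDeath.


(** * Lebesgue integrals of explicit functions *)

Section LebesgueIntegrals.
Context {R : realType}.
Notation leb := (@lebesgue_measure R).
Implicit Types (f F : R -> R) (a b c x : R).

Lemma integrable_continuous_itvcc f a b :
  (forall x, x \in `[a, b]%R -> {for x, continuous f}) ->
  leb.-integrable `[a, b] (EFin \o f).
Proof.
move=> cf; apply: continuous_compact_integrable; first exact: segment_compact.
by apply: continuous_in_subspaceT => x; rewrite inE /= => /cf.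
Qed.

Lemma is_derive_cvg F x (df : R) : is_derive x 1 F df -> {for x, continuous F}.
Proof.
move=> dx; apply: differentiable_continuous.
by apply/derivable1_diffP; exact: ex_derive.
Qed.

Lemma Rintegral_FTC f F a b : a <= b ->
  (forall x, x \in `[a, b]%R -> is_derive x 1 F (f x)) ->
  (forall x, x \in `[a, b]%R -> {for x, continuous f}) ->
  \int[leb]_(x in `[a, b]) f x = F b - F a.
Proof.
rewrite le_eqVlt => /predU1P[<- _ _|ab dF cf].
  by rewrite set_itv1 Rintegral_set1 subrr.
have Fc x : x \in `[a, b]%R -> F y @[y --> x] --> F x.
  by move=> /dF; exact: is_derive_cvg.
rewrite /Rintegral (@continuous_FTC2 _ f F) //.
- by apply: continuous_in_subspaceT => x; rewrite inE /= => /cf.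
- split.
  + move=> x xab; apply: ex_derive; apply: dF.
    exact: subset_itv_oo_cc xab.
  + by apply: cvg_at_right_filter; apply: Fc; rewrite in_itv /= lexx ltW.
  + by apply: cvg_at_left_filter; apply: Fc; rewrite in_itv /= lexx ltW.
- move=> x xab; rewrite derive1E.
  by have [_ ->] := dF x (subset_itv_oo_cc xab).
Qed.

Lemma continuous_expR_affine (k c x : R) :
  {for x, continuous (fun y : R => expR (k * (y - c)))}.
Proof.
have c1 : {for x, continuous (fun y : R => k * (y - c))}.
  apply: cvgM; first exact: cvg_cst.
  by apply: cvgB; [exact: cvg_id|exact: cvg_cst].
by apply: (continuous_comp c1); exact: continuous_expR.
Qed.

Lemma is_derive_expR_affine (k c x : R) : k != 0 ->
  is_derive x 1 (fun y : R => k^-1 * expR (k * (y - c))) (expR (k * (x - c))).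
Proof.
move=> k0.
have d1 : is_derive x 1 (fun y : R => k * (y - c)) k.
  by apply: is_derive_eq; rewrite /GRing.scale /=; ring.
have d2 := @is_derive1_comp _ expR (fun y : R => k * (y - c)) _ _ _
  (is_derive_expR _) d1.
have -> : expR (k * (x - c)) = k^-1 *: (expR (k * (x - c)) * k).
  by rewrite /GRing.scale /= mulrCA mulVf // mulr1.
exact: is_deriveZ.
Qed.

Lemma integral_expR_itvcy (k z : R) : 0 < k ->
  (\int[leb]_(x in `[z, +oo[) (expR (- k * (x - z)))%:E)%E = (k^-1)%:E.
Proof.
move=> k0; have nk : - k != 0 by rewrite oppr_eq0 gt_eqF.
rewrite (@ge0_continuous_FTC2y _ _ (fun y => (- k)^-1 * expR (- k * (y - z))) _ 0).
- by rewrite subrr mulr0 expR0 mulr1 -EFinB sub0r invrN opprK.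
- by move=> x _; exact: expR_ge0.
- by apply: continuous_in_subspaceT => x _; exact: continuous_expR_affine.
- rewrite -[X in _ --> X](mulr0 (- k)^-1); apply: cvgM; first exact: cvg_cst.
  have -> : (fun x => expR (- k * (x - z))) =
      (fun x => expR (- x)) \o (fun x => k * (x - z)).
    by apply/funext => x /=; rewrite mulNr.
  apply: (cvg_comp _ _ _ (@cvgr_expR R)).
  by apply: gt0_cvgMry => //; exact: cvg_addrr.
- by move=> x _; by have [] := is_derive_expR_affine z x nk.
- apply: cvg_at_right_filter.
  exact: (is_derive_cvg (is_derive_expR_affine z z nk)).
- move=> x _; rewrite derive1E.
  by have [_ ->] := is_derive_expR_affine z x nk.
Qed.

Lemma integral_expR_itvNyc (k b : R) : 0 < k ->
  (\int[leb]_(x in `]-oo, b]) (expR (k * (x - b)))%:E)%E = (k^-1)%:E.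
Proof.
move=> k0; rewrite -[in `]-oo, b]](opprK b) ge0_integration_by_substitutionNy.
- rewrite -(integral_expR_itvcy (- b) k0); apply: eq_integral => x _ /=.
  by congr (expR _)%:E; ring.
- by apply: continuous_in_subspaceT => x _; exact: continuous_expR_affine.
- by move=> x _; exact: expR_ge0.
Qed.

Lemma integrable_ge0 f (A : set R) (r : R) : measurable A -> measurable_fun A f ->
  (forall x, A x -> 0 <= f x) ->
  (\int[leb]_(x in A) (f x)%:E)%E = r%:E -> leb.-integrable A (EFin \o f).
Proof.
move=> mA mf f0 e; apply/integrableP; split; first exact/measurable_EFinP.
rewrite (_ : integral _ _ _ = r%:E) ?ltry // -e; apply: eq_integral => x.
by rewrite inE => /f0 fx /=; rewrite ger0_norm.
Qed.

Lemma integrable_itvW f (i j : interval R) : {subset j <= i} ->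
  leb.-integrable [set` i] (EFin \o f) -> leb.-integrable [set` j] (EFin \o f).
Proof. by move=> ij; apply: integrableS. Qed.

Lemma Rintegral_itv_cat f (i : itv_bound R) a b : (i <= BLeft a)%O -> a <= b ->
  leb.-integrable [set` Interval i (BRight b)] (EFin \o f) ->
  \int[leb]_(x in [set` Interval i (BRight b)]) f x =
  \int[leb]_(x in [set` Interval i (BRight a)]) f x +
  \int[leb]_(x in `[a, b]) f x.
Proof.
move=> ia ab fi.
rewrite -[LHS](subrK (\int[leb]_(x in [set` Interval i (BRight a)]) f x)) addrC.
rewrite Rintegral_itvB //; last by rewrite (le_trans ia) // bnd_simp.
congr (_ + _); rewrite Rintegral_itv_obnd_cbnd //.
apply: integrable_itvW fi; apply: subitvP; rewrite subitvE /= lexx andbT.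
by rewrite (le_trans ia) // bnd_simp.
Qed.

Lemma Rintegral_quadratic (p q r c h : R) : 0 <= h ->
  \int[leb]_(x in `[c - h, c + h]) (p + q * (x - c) + r * (x - c) ^+ 2) =
  2 * h * p + 2 / 3 * h ^+ 3 * r.
Proof.
move=> h0.
pose F (x : R) := p * x + q / 2 * (x - c) ^+ 2 + r / 3 * (x - c) ^+ 3.
pose f (x : R) := p + q * (x - c) + r * (x - c) ^+ 2.
have dF x : x \in `[c - h, c + h]%R -> is_derive x 1 F (f x).
  by move=> _; rewrite /F /f; apply: is_derive_eq; rewrite /GRing.scale /=; field.
have cf x : x \in `[c - h, c + h]%R -> {for x, continuous f}.
  by move=> _; apply: is_derive_cvg.
have ch : c - h <= c + h by lra.
by rewrite (Rintegral_FTC ch dF cf) /F; field.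
Qed.

Lemma integrable_quadratic (p q r c h : R) :
  leb.-integrable `[c - h, c + h]
    (EFin \o (fun x => p + q * (x - c) + r * (x - c) ^+ 2)).
Proof.
by apply: integrable_continuous_itvcc => x _; apply: is_derive_cvg.
Qed.

Lemma Rintegral_le_quadratic f (p q r c h : R) : 0 <= h ->
  leb.-integrable `[c - h, c + h] (EFin \o f) ->
  (forall y, `|y| <= h -> f (c + y) <= p + q * y + r * y ^+ 2) ->
  \int[leb]_(x in `[c - h, c + h]) f x <= 2 * h * p + 2 / 3 * h ^+ 3 * r.
Proof.
move=> h0 fi fle; rewrite -(Rintegral_quadratic p q r c h0).
apply: le_Rintegral => //; first exact: integrable_quadratic.
move=> x /=; rewrite in_itv /= => /andP[x1 x2].
rewrite -{1}(subrK c x) addrC; apply: fle.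
by rewrite ler_norml; apply/andP; split; lra.
Qed.

Lemma Rintegral_ge_quadratic f (p q r c h : R) : 0 <= h ->
  leb.-integrable `[c - h, c + h] (EFin \o f) ->
  (forall y, `|y| <= h -> p + q * y + r * y ^+ 2 <= f (c + y)) ->
  2 * h * p + 2 / 3 * h ^+ 3 * r <= \int[leb]_(x in `[c - h, c + h]) f x.
Proof.
move=> h0 fi fle; rewrite -(Rintegral_quadratic p q r c h0).
apply: le_Rintegral => //; first exact: integrable_quadratic.
move=> x /=; rewrite in_itv /= => /andP[x1 x2].
rewrite -{3}(subrK c x) [x - c + c]addrC; apply: fle.
by rewrite ler_norml; apply/andP; split; lra.
Qed.

End LebesgueIntegrals.


(** * The density of the diffusion *)

Section DiffusionDensity.
Context {R : realType}.
Notation leb := (@lebesgue_measure R).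
Implicit Types x y z : R.

Definition clamp (dl a x : R) : R := Num.max (- dl^-1) (Num.min x a).

(** The quotient of twice the drift by the diffusion coefficient.  Clamping gives
    one formula for the three regimes, hence a function that is visibly
    continuous. *)
Definition drift_ratio (dl a x : R) : R :=
  - 2 * Num.min x a / (2 + dl * clamp dl a x).

(** The antiderivative of [drift_ratio] between [- dl^-1] and [a]. *)
Definition mid_potential (dl x : R) : R :=
  - (2 / dl) * x + 4 / dl ^+ 2 * ln (1 + dl / 2 * x).

Definition decay (dl a : R) : R := 2 * a / (2 + dl * a).

(** The antiderivative of [drift_ratio] on the whole line that vanishes at
    zero. *)
Definition potential (dl a x : R) : R :=
  mid_potential dl (clamp dl a x) + (dl^-1 ^+ 2 - Num.min x (- dl^-1) ^+ 2)
  - decay dl a * Num.max (x - a) 0.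

Definition density (dl a mu x : R) : R :=
  (mu * (2 + dl * clamp dl a x))^-1 * expR (potential dl a x).

Variables (dl a mu : R).

Lemma one_le_2Dmul x : 0 < dl -> - dl^-1 <= x -> 1 <= 2 + dl * x.
Proof.
move=> dl0 hx; have : dl * - dl^-1 <= dl * x by rewrite ler_pM2l.
by rewrite mulrN divff ?gt_eqF //; lra.
Qed.

Lemma clamp_mid x : - dl^-1 <= x -> x <= a -> clamp dl a x = x.
Proof.
by move=> h1 h2; rewrite /clamp (@min_idPl _ _ x a h2) (@max_idPr _ _ _ _ h1).
Qed.

Lemma clamp_right x : 0 < dl -> 0 < a -> a <= x -> clamp dl a x = a.
Proof.
move=> dl0 a0 h; have i0 : 0 < dl^-1 by rewrite invr_gt0.
have h' : - dl^-1 <= a by lra.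
by rewrite /clamp (@min_idPr _ _ x a h) max_r.
Qed.

Lemma clamp_left x : 0 < dl -> 0 < a -> x <= - dl^-1 ->
  clamp dl a x = - dl^-1.
Proof.
move=> dl0 a0 h; have i0 : 0 < dl^-1 by rewrite invr_gt0.
have h' : x <= a by lra.
by rewrite /clamp (min_l h') max_l.
Qed.

Lemma clamp_ge1 x : 0 < dl -> 1 <= 2 + dl * clamp dl a x.
Proof. by move=> dl0; apply: one_le_2Dmul; rewrite // /clamp le_max lexx. Qed.

Lemma drift_ratio_mid x : - dl^-1 <= x -> x <= a ->
  drift_ratio dl a x = - 2 * x / (2 + dl * x).
Proof. by move=> h1 h2; rewrite /drift_ratio clamp_mid // min_l. Qed.

Lemma drift_ratio_right x : 0 < dl -> 0 < a -> a <= x ->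
  drift_ratio dl a x = - decay dl a.
Proof.
by move=> dl0 a0 h; rewrite /drift_ratio clamp_right // min_r // !mulNr.
Qed.

Lemma drift_ratio_left x : 0 < dl -> 0 < a -> x <= - dl^-1 ->
  drift_ratio dl a x = - 2 * x.
Proof.
move=> dl0 a0 h; have i0 : 0 < dl^-1 by rewrite invr_gt0.
have xa : x <= a by lra.
rewrite /drift_ratio clamp_left // (min_l xa) mulrN divff ?gt_eqF //.
by rewrite (_ : 2 - 1 = 1 :> R) ?divr1 //; lra.
Qed.

Lemma continuous_clamp x : {for x, continuous (clamp dl a)}.
Proof.
have c1 : {for x, continuous ((@id R) \min (cst a))}.
  by apply: continuous_min; [exact: cvg_id|exact: cvg_cst].
have : {for x, continuous ((cst (- dl^-1)) \max ((@id R) \min (cst a)))}.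
  by apply: continuous_max => //; exact: cvg_cst.
exact.
Qed.

Lemma continuous_drift_ratio x : 0 < dl ->
  {for x, continuous (drift_ratio dl a)}.
Proof.
move=> dl0.
have c1 : {for x, continuous ((@id R) \min (cst a))}.
  by apply: continuous_min; [exact: cvg_id|exact: cvg_cst].
have c2 : {for x, continuous (fun y => 2 + dl * clamp dl a y)}.
  apply: cvgD; first exact: cvg_cst.
  by apply: cvgM; [exact: cvg_cst|exact: continuous_clamp].
apply: cvgM; first by apply: cvgM; [exact: cvg_cst|exact: c1].
by apply: cvgV => //; rewrite gt_eqF // (lt_le_trans _ (clamp_ge1 x dl0)).
Qed.

Lemma is_derive_mid_potential x : 0 < dl -> - dl^-1 <= x ->
  is_derive x 1 (mid_potential dl) (- 2 * x / (2 + dl * x)).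
Proof.
move=> dl0 hx.
have h1 : - 1 <= dl * x.
  by rewrite -(@divff _ dl) ?gt_eqF // -mulrN ler_pM2l.
have h2 : 0 < 1 + dl / 2 * x by lra.
have := is_derive_ln_affine h2.
move=> d; rewrite /mid_potential; apply: is_derive_eq; rewrite /GRing.scale /=.
by field; rewrite !gt_eqF //=; lra.
Qed.

Lemma mid_potential0 : mid_potential dl 0 = 0.
Proof. by rewrite /mid_potential !mulr0 addr0 ln1 mulr0 addr0. Qed.

Lemma potential_mid x : - dl^-1 <= x -> x <= a ->
  potential dl a x = mid_potential dl x.
Proof.
move=> h1 h2; have h3 : x - a <= 0 by lra.
rewrite /potential clamp_mid // (min_r h1) (max_r h3).
by rewrite sqrrN subrr mulr0 addr0 subr0.
Qed.

Lemma potential_right x : 0 < dl -> 0 < a -> a <= x ->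
  potential dl a x = mid_potential dl a - decay dl a * (x - a).
Proof.
move=> dl0 a0 h; have i0 : 0 < dl^-1 by rewrite invr_gt0.
have h1 : 0 <= x - a by lra.
have h2 : - dl^-1 <= x by lra.
rewrite /potential clamp_right // (min_r h2) (max_l h1).
by rewrite sqrrN subrr addr0.
Qed.

Lemma potential_left x : 0 < dl -> 0 < a -> x <= - dl^-1 ->
  potential dl a x = mid_potential dl (- dl^-1) + (dl^-1 ^+ 2 - x ^+ 2).
Proof.
move=> dl0 a0 h; have i0 : 0 < dl^-1 by rewrite invr_gt0.
have h1 : x - a <= 0 by lra.
by rewrite /potential clamp_left // (min_l h) (max_r h1) mulr0 subr0.
Qed.

(** The integral is split at [- dl^-1] and at [a], where [drift_ratio] changes
    its formula but stays continuous. *)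
Lemma oriented_integral_drift_ratio x : 0 < dl -> 0 < a ->
  oriented_integral (drift_ratio dl a) 0 x = potential dl a x.
Proof.
move=> dl0 a0.
have i0 : 0 < dl^-1 by rewrite invr_gt0.
have cg y z : forall w, w \in `[y, z]%R -> {for w, continuous (drift_ratio dl a)}.
  by move=> w _; exact: continuous_drift_ratio.
have mid y z : - dl^-1 <= y -> y <= z -> z <= a ->
    \int[leb]_(w in `[y, z]) drift_ratio dl a w =
    mid_potential dl z - mid_potential dl y.
  move=> h1 h2 h3.
  have dF w : w \in `[y, z]%R ->
      is_derive w 1 (mid_potential dl) (drift_ratio dl a w).
    rewrite in_itv /= => /andP[yw wz].
    have [h4 h5] : - dl^-1 <= w /\ w <= a by split; lra.
    rewrite (drift_ratio_mid h4 h5); exact: is_derive_mid_potential.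
  exact: (Rintegral_FTC h2 dF (cg _ _)).
rewrite /oriented_integral.
have [x0|x0] := leP 0 x.
  have [xa|xa] := leP x a.
    have h1 : - dl^-1 <= x by lra.
    have h2 : - dl^-1 <= 0 by lra.
    by rewrite (mid _ _ h2 x0 xa) (potential_mid h1 xa) mid_potential0 subr0.
  rewrite (@Rintegral_itv_cat _ _ _ a); first last.
  - by apply: integrable_continuous_itvcc => w _; exact: continuous_drift_ratio.
  - exact: ltW.
  - by rewrite bnd_simp ltW.
  have h2 : - dl^-1 <= 0 by lra.
  rewrite (potential_right dl0 a0 (ltW xa)) (mid _ _ h2 (ltW a0) (lexx a)).
  rewrite mid_potential0 subr0.
  pose F (w : R) := - decay dl a * w.
  have dF w : w \in `[a, x]%R -> is_derive w 1 F (drift_ratio dl a w).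
    rewrite in_itv /= => /andP[aw wx]; rewrite drift_ratio_right //.
    by apply: is_derive_eq; rewrite /GRing.scale /=; ring.
  by rewrite (Rintegral_FTC (ltW xa) dF (cg _ _)) /F ; lra.
have [xd|xd] := leP (- dl^-1) x.
  have h2 : x <= a by lra.
  rewrite (mid _ _ xd (ltW x0) (ltW a0)) (potential_mid xd h2).
  by rewrite mid_potential0 sub0r opprK.
rewrite (@Rintegral_itv_cat _ _ _ (- dl^-1)); first last.
- by apply: integrable_continuous_itvcc => w _; exact: continuous_drift_ratio.
- lra.
- by rewrite bnd_simp ltW.
have h2 : - dl^-1 <= 0 by lra.
rewrite (potential_left dl0 a0 (ltW xd)) (mid _ _ (lexx _) h2 (ltW a0)).
rewrite mid_potential0 sub0r.
pose F (w : R) := - w ^+ 2.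
have dF w : w \in `[x, - dl^-1]%R -> is_derive w 1 F (drift_ratio dl a w).
  rewrite in_itv /= => /andP[aw wx]; rewrite drift_ratio_left //.
  by apply: is_derive_eq; rewrite /GRing.scale /=; ring.
by rewrite (Rintegral_FTC (ltW xd) dF (cg _ _)) /F ; lra.
Qed.

Lemma density_gt0 x : 0 < dl -> 0 < mu -> 0 < density dl a mu x.
Proof.
move=> dl0 mu0; have c1 := clamp_ge1 x dl0.
by rewrite mulr_gt0 ?expR_gt0 // invr_gt0 mulr_gt0 // (lt_le_trans _ c1).
Qed.

Lemma density_mid x : - dl^-1 <= x -> x <= a ->
  density dl a mu x = (mu * (2 + dl * x))^-1 * expR (mid_potential dl x).
Proof. by move=> h1 h2; rewrite /density clamp_mid // potential_mid. Qed.

Lemma density_right x : 0 < dl -> 0 < a -> a <= x ->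
  density dl a mu x = density dl a mu a * expR (- decay dl a * (x - a)).
Proof.
move=> dl0 a0 h; rewrite /density -[RHS]mulrA -expRD !clamp_right //.
by rewrite !potential_right // subrr mulr0 subr0 mulNr.
Qed.

(** The exponent [dl^-1 ^+ 2 - x ^+ 2] lies below its tangent at [- dl^-1]. *)
Lemma density_left x : 0 < dl -> 0 < a -> 0 < mu -> x <= - dl^-1 ->
  density dl a mu x <=
  density dl a mu (- dl^-1) * expR (2 / dl * (x - - dl^-1)).
Proof.
move=> dl0 a0 mu0 h; have i0 : 0 < dl^-1 by rewrite invr_gt0.
rewrite /density -[leRHS]mulrA -expRD !clamp_left //; apply: ler_wpM2l.
  by rewrite invr_ge0 mulr_ge0 ?(ltW mu0) // mulrN divff ?gt_eqF //; lra.
rewrite ler_expR !potential_left //.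
have := sqr_ge0 (x + dl^-1); set i := dl^-1; rewrite sqrrN; nra.
Qed.

Lemma continuous_density x : 0 < dl -> 0 < mu ->
  {for x, continuous (density dl a mu)}.
Proof.
move=> dl0 mu0.
have cc := @continuous_clamp.
have g1 := clamp_ge1 x dl0.
have c2 : {for x, continuous (fun y => 2 + dl * clamp dl a y)}.
  apply: cvgD; first exact: cvg_cst.
  by apply: cvgM; [exact: cvg_cst|exact: cc].
have c3 : {for x, continuous ((@id R) \min (cst (- dl^-1)))}.
  by apply: continuous_min; [exact: cvg_id|exact: cvg_cst].
have c4 : {for x, continuous ((fun y : R => y - a) \max (cst 0))}.
  apply: continuous_max; last exact: cvg_cst.
  by apply: cvgB; [exact: cvg_id|exact: cvg_cst].
have c5 : {for x, continuous (mid_potential dl \o clamp dl a)}.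
  apply: continuous_comp; first exact: cc.
  have h : - dl^-1 <= clamp dl a x by rewrite /clamp le_max lexx.
  exact: (is_derive_cvg (is_derive_mid_potential dl0 h)).
apply: cvgM.
  apply: cvgV; last by apply: cvgM; [exact: cvg_cst|exact: c2].
  by rewrite gt_eqF // mulr_gt0 //; lra.
have c6 : {for x, continuous (potential dl a)}.
  apply: cvgB; last by apply: cvgM; [exact: cvg_cst|exact: c4].
  apply: cvgD; first exact: c5.
  by apply: cvgB; [exact: cvg_cst|apply: cvgM; exact: c3].
by apply: (continuous_comp c6); exact: continuous_expR.
Qed.

Lemma measurable_density (D : set R) : 0 < dl -> 0 < mu -> measurable D ->
  measurable_fun D (density dl a mu).
Proof.
move=> dl0 mu0 mD; apply: measurable_funTS; apply: continuous_measurable_fun => x.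
exact: continuous_density.
Qed.

End DiffusionDensity.


(** * The tail of the diffusion *)

Section DiffusionTail.
Context {R : realType}.
Notation leb := (@lebesgue_measure R).

Lemma unnormalized_densityE (lam mu : R) (n : nat) (x : R) :
  0 < delta lam mu -> zeta lam mu n < 0 -> 0 < mu ->
  unnormalized_density lam mu n x =
  density (delta lam mu) (- zeta lam mu n) mu x.
Proof.
set dl := delta lam mu; set a := - zeta lam mu n => dl0 z0 mu0.
have a0 : 0 < a by rewrite /a; lra.
have i0 : 0 < dl^-1 by rewrite invr_gt0.
have diffE y : diffusion lam mu n y = mu * (2 + dl * clamp dl a y).
  rewrite /diffusion -/dl -/a.
  have [yd|yd] := leP y (- dl^-1).
    by rewrite clamp_left // mulrN divff ?gt_eqF // -[LHS]mulr1; congr (_ * _); lra.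
  have [ya|ya] := leP y a; first by rewrite clamp_mid // ltW.
  by rewrite clamp_right ?ltW // ltr0_norm.
rewrite /unnormalized_density diffE /density -(oriented_integral_drift_ratio x dl0 a0).
congr (_ * expR (oriented_integral _ 0 x)); apply/funext => y.
rewrite diffE /drift -/a /drift_ratio.
have c1 := clamp_ge1 a y dl0.
have [ya|ya] := leP y a.
  by field; rewrite !gt_eqF //; lra.
rewrite /a; field; rewrite !gt_eqF //; lra.
Qed.

(** The normalizing constant is finite because the density has total mass one:
    an infinite integral would have inverse zero. *)
Lemma scaled_density_tail (dl a mu : R) (nu : probability R R) :
  0 < dl -> 0 < a -> 0 < mu ->
  (forall A : set R, measurable A -> nu A = \int[leb]_(x in A)
     ((\int[leb]_(x in [set: R]) density dl a mu x)^-1 * density dl a mu x)%:E)%E ->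
  leb.-integrable setT (EFin \o density dl a mu) /\
  forall z, a <= z ->
  fine (nu [set` `[z, +oo[%R]) =
  expR (- decay dl a * (z - a)) /
  (1 + decay dl a *
     (\int[leb]_(x in `]-oo, a]) density dl a mu x / density dl a mu a)).
Proof.
move=> dl0 a0 mu0; set f := density dl a mu; set K := \int[leb]_(x in setT) f x => nuE.
have f0 x : 0 < f x by exact: density_gt0.
have mf (D : set R) : measurable D -> measurable_fun D f by exact: measurable_density.
have nu1 := nuE setT measurableT; rewrite probability_setT in nu1.
have fi : leb.-integrable setT (EFin \o f).
  apply/integrableP; split; first by apply/measurable_EFinP; exact: mf.
  rewrite (_ : integral _ _ _ = \int[leb]_x (f x)%:E)%E; last first.
    by apply: eq_integral => x _ /=; rewrite gtr0_norm.
  rewrite ltNge leye_eq; apply/negP => /eqP Ky.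
  move: nu1; rewrite /K /Rintegral Ky /= invr0.
  under eq_integral do rewrite mul0r.
  by rewrite integral0 => /eqP; rewrite eqe oner_eq0.
split=> // z az.
have fiS (i : interval R) : leb.-integrable [set` i] (EFin \o f).
  exact: integrableS fi.
set th := decay dl a.
have th0 : 0 < th by apply: divr_gt0; nra.
have tailE y : a <= y -> \int[leb]_(x in `[y, +oo[) f x =
    f a * expR (- th * (y - a)) / th.
  move=> ay.
  have mE : measurable_fun (`[y, +oo[ : set R) (fun x => expR (- th * (x - y))).
    apply: measurable_funTS; apply: continuous_measurable_fun.
    exact: continuous_expR_affine.
  have ie := integral_expR_itvcy y th0.
  have iE := @integrable_ge0 _ _ _ _ (measurable_itv _) mE
    (fun x _ => expR_ge0 _) ie.
  transitivity (\int[leb]_(x in `[y, +oo[)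
      (f a * expR (- th * (y - a)) * expR (- th * (x - y)))).
    apply: eq_Rintegral => x; rewrite inE /= in_itv /= andbT => yx.
    rewrite /f (density_right mu dl0 a0 (le_trans ay yx)) -mulrA -expRD.
    by congr (_ * expR _); rewrite -/th; ring.
  by rewrite RintegralZl // /Rintegral ie.
have split_K : K = \int[leb]_(x in `]-oo, a]) f x + f a / th.
  have UT : [set: R] = `]-oo, a] `|` `]a, +oo[.
    by rewrite -itv_bndbnd_setU // set_itvNyy.
  rewrite /K UT Rintegral_setU //=; first last.
  - apply/disj_setPS => x [/=]; rewrite 2!in_itv /= => xa.
    by rewrite andbT ltNge xa.
  - by rewrite -UT.
  by rewrite Rintegral_itv_obnd_cbnd // tailE // subrr mulr0 expR0 mulr1.
have I0 : 0 <= \int[leb]_(x in `]-oo, a]) f x.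
  by apply: Rintegral_ge0 => x _; exact: ltW.
rewrite nuE // -/(Rintegral _ _ _) RintegralZl // tailE // split_K.
have fa := f0 a.
set I := Rintegral _ _ _ in I0 *.
have t1 : 0 < I * th + f a by nra.
have t2 : 0 < f a + th * I by nra.
by field; rewrite !gt_eqF.
Qed.

Lemma YS_tail (lam mu : R) (n : nat) (nu : probability R R) :
  0 < delta lam mu -> zeta lam mu n < 0 -> 0 < mu ->
  has_density nu (YS_density lam mu n) ->
  let dl := delta lam mu in let a := - zeta lam mu n in
  leb.-integrable setT (EFin \o density dl a mu) /\
  forall z, a <= z ->
  fine (nu [set` `[z, +oo[%R]) =
  expR (- decay dl a * (z - a)) /
  (1 + decay dl a *
     (\int[leb]_(x in `]-oo, a]) density dl a mu x / density dl a mu a)).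
Proof.
move=> dl0 z0 mu0 hd dl a; apply: scaled_density_tail => //.
  by rewrite oppr_gt0.
move=> A mA; rewrite hd //; apply: eq_integral => x _.
rewrite /YS_density /kappa unnormalized_densityE //.
congr ((_^-1 * _)%:E); apply: eq_Rintegral => y _.
exact: unnormalized_densityE.
Qed.

End DiffusionTail.


(** * Local behaviour of the density *)

Section LocalDensityBounds.
Context {R : realType}.
Implicit Types dl a mu c d x y : R.

(** With [w = dl * x], the potential times [dl ^+ 2] is
    [4 * ln (1 + w / 2) - 2 * w], which expands as
    [- w ^+ 2 / 2 + w ^+ 3 / 6]; the weaker constant [1 / 4] holds
    uniformly for [w] between [- 1] and [1]. *)
Lemma mid_potential_le dl x : 0 < dl -> - 1 <= dl * x -> dl * x <= 1 ->
  mid_potential dl x <= - (x ^+ 2 / 4).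
Proof.
move=> dl0; set w := dl * x => w1 w2.
have E : mid_potential dl x = (- 2 * w + 4 * ln (1 + w / 2)) / dl ^+ 2.
  rewrite /mid_potential (_ : dl / 2 * x = w / 2); last by rewrite /w; ring.
  by rewrite /w; field; rewrite gt_eqF.
have -> : - (x ^+ 2 / 4) = - (w ^+ 2 / 4) / dl ^+ 2.
  by rewrite /w; field; rewrite gt_eqF.
rewrite E ler_pM2r ?invr_gt0 ?exprn_gt0 //.
suff : ln (1 + w / 2) <= w / 2 - w ^+ 2 / 16 by lra.
clear E; clearbody w.
have yE : (1 + w / 2 - 1) / (1 + w / 2 + 1) = w / (4 + w).
  by field; rewrite !gt_eqF //; lra.
have [w0|w0] := leP 0 w.
  have hx : 1 <= 1 + w / 2 <= 3 by apply/andP; split; lra.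
  have /andP[_] := ln_ge1_bounds hx; rewrite yE => /le_trans; apply.
  rewrite -subr_ge0.
  have -> : w / 2 - w ^+ 2 / 16 - (2 * (w / (4 + w)) + 2 * (w / (4 + w)) ^+ 3) =
     w ^+ 2 * (64 - 16 * w - 4 * w ^+ 2 - w ^+ 3) / (16 * (4 + w) ^+ 3).
    by field; rewrite gt_eqF //; lra.
  apply: divr_ge0; last by apply: mulr_ge0 => //; apply: exprn_ge0; lra.
  by apply: mulr_ge0; [exact: sqr_ge0|nra].
have hx : 1 / 3 <= 1 + w / 2 <= 1 by apply/andP; split; lra.
have /andP[_] := ln_le1_bounds hx; rewrite yE => /le_trans; apply.
rewrite -subr_ge0.
have -> : w / 2 - w ^+ 2 / 16 - 2 * (w / (4 + w)) =
    w ^+ 2 * (4 - w) / (16 * (4 + w)).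
  by field; rewrite gt_eqF //; lra.
by apply: divr_ge0; [apply: mulr_ge0; [exact: sqr_ge0|lra]|lra].
Qed.

Lemma mid_potential_ge dl x : 0 < dl -> 0 <= dl * x -> dl * x <= 1 ->
  - (x ^+ 2 / 2) <= mid_potential dl x.
Proof.
move=> dl0; set w := dl * x => w1 w2.
have E : mid_potential dl x = (- 2 * w + 4 * ln (1 + w / 2)) / dl ^+ 2.
  rewrite /mid_potential (_ : dl / 2 * x = w / 2); last by rewrite /w; ring.
  by rewrite /w; field; rewrite gt_eqF.
have -> : - (x ^+ 2 / 2) = - (w ^+ 2 / 2) / dl ^+ 2.
  by rewrite /w; field; rewrite gt_eqF.
rewrite E ler_pM2r ?invr_gt0 ?exprn_gt0 //.
suff : w / 2 - w ^+ 2 / 8 <= ln (1 + w / 2) by lra.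
clear E; clearbody w.
have yE : (1 + w / 2 - 1) / (1 + w / 2 + 1) = w / (4 + w).
  by field; rewrite !gt_eqF //; lra.
have hx : 1 <= 1 + w / 2 <= 3 by apply/andP; split; lra.
have /andP[+ _] := ln_ge1_bounds hx; rewrite yE; apply: le_trans.
rewrite -subr_ge0.
have -> : 2 * (w / (4 + w)) - (w / 2 - w ^+ 2 / 8) = w ^+ 3 / (8 * (4 + w)).
  by field; rewrite gt_eqF //; lra.
by apply: divr_ge0; [exact: exprn_ge0|lra].
Qed.

Lemma density_ratio dl a mu c d : 0 < dl -> 0 < mu ->
  - dl^-1 <= c -> c <= a -> - dl^-1 <= d -> d <= a ->
  density dl a mu d = density dl a mu c *
    expR (- (2 / dl) * (d - c) +
          (4 / dl ^+ 2 - 1) * ln ((2 + dl * d) / (2 + dl * c))).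
Proof.
move=> dl0 mu0 c1 c2 d1 d2.
have c3 := one_le_2Dmul dl0 c1; have d3 := one_le_2Dmul dl0 d1.
rewrite !density_mid //.
set L := ln _.
have Lc : ln (1 + dl / 2 * d) = ln (1 + dl / 2 * c) + L.
  rewrite /L -lnM ?posrE; try (by rewrite ?divr_gt0 //; lra).
  by congr ln; field; lra.
have -> : expR (- (2 / dl) * (d - c) + (4 / dl ^+ 2 - 1) * L) =
    expR (mid_potential dl d - mid_potential dl c) * (2 + dl * c) / (2 + dl * d).
  rewrite -[RHS]mulrA -[(2 + dl * c) / _]invrK invf_div -(@lnK _ ((2 + dl * d) / _)).
    by rewrite -/L -expRN -expRD; congr expR; rewrite /mid_potential Lc; ring.
  by rewrite posrE divr_gt0 //; lra.
rewrite expRD expRN; field.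
by rewrite expR_eq0 !gt_eqF //=; lra.
Qed.

(** The logarithmic derivative of the density at a point [c] between [- dl^-1]
    and [a]. *)
Definition slope dl c : R := - (2 * c + dl) / (2 + dl * c).

Lemma slope_le dl c : 0 < dl -> - dl^-1 <= c ->
  `|slope dl c| <= 2 * `|c| + dl.
Proof.
move=> dl0 hc; have c3 := one_le_2Dmul dl0 hc.
rewrite /slope normrM normfV normrN (@ger0_norm _ (2 + _)); last lra.
rewrite ler_pdivrMr; last lra.
have h : `|2 * c + dl| <= 2 * `|c| + dl.
  apply: le_trans (ler_normD _ _) _.
  by rewrite normrM (@ger0_norm _ 2) // (gtr0_norm dl0).
have : 0 <= 2 * `|c| + dl by apply: addr_ge0; [rewrite mulr_ge0|exact: ltW].
by nra.
Qed.

Lemma slope_mul_le1 dl c y : 0 < dl -> dl ^+ 2 <= 2 -> - dl^-1 <= c ->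
  `|y| <= dl / 2 -> `|slope dl c * y| <= 1.
Proof.
move=> dl0 dl2 hc hy; have c3 := one_le_2Dmul dl0 hc.
have hs : `|slope dl c| <= 2 / dl.
  rewrite /slope normrM normfV normrN (@ger0_norm _ (2 + _)); last lra.
  rewrite ler_pdivrMr; last lra.
  have -> : 2 / dl * (2 + dl * c) = (4 + 2 * (dl * c)) / dl by field; rewrite gt_eqF.
  rewrite ler_pdivlMr // -[X in _ * X](gtr0_norm dl0) -normrM.
  rewrite ler_norml; apply/andP; split; nra.
rewrite normrM; apply: (@le_trans _ _ (2 / dl * (dl / 2))).
  by apply: ler_pM.
by rewrite mulrA divfK ?gt_eqF //; lra.
Qed.

(** The density is log-concave with second logarithmic derivative bounded by
    a constant, so on a cell of width [dl] it lies between two parabolas that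
    share its value and slope at [c].  The linear terms integrate to zero over
    a centred cell, which is why the midpoint rule is accurate to second
    order. *)
Lemma density_cell dl a mu c y : 0 < dl -> dl ^+ 2 <= 2 -> 0 < mu ->
  - dl^-1 + dl <= c -> c <= a -> c + y <= a -> `|y| <= dl / 2 ->
  density dl a mu c * (1 + slope dl c * y - 4 * y ^+ 2)
    <= density dl a mu (c + y)
    <= density dl a mu c * (1 + slope dl c * y + 2 * (slope dl c * y) ^+ 2).
Proof.
move=> dl0 dl2 mu0 hc ca cya hy.
have hc' : - dl^-1 <= c by lra.
have c3 := one_le_2Dmul dl0 hc'.
have hcy : - dl^-1 <= c + y by move: hy; rewrite ler_norml => /andP[]; lra.
have s1 := slope_mul_le1 dl0 dl2 hc' hy.
have c4 : 1 + dl ^+ 2 <= 2 + dl * c.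
  have : dl * (- dl^-1 + dl) <= dl * c by rewrite ler_pM2l.
  rewrite mulrDr mulrN divff ?gt_eqF // -expr2; lra.
rewrite (density_ratio dl0 mu0 hc' ca hcy cya).
have f0 : 0 < density dl a mu c.
  by rewrite density_mid // mulr_gt0 ?expR_gt0 // invr_gt0 mulr_gt0 //; lra.
rewrite !ler_pM2l // (_ : c + y - c = y); last by ring.
set v := dl * y / (2 + dl * c).
have -> : (2 + dl * (c + y)) / (2 + dl * c) = 1 + v by rewrite /v; field; lra.
have hv : `|v| <= 1 / 2.
  rewrite /v normrM normfV (@ger0_norm _ (2 + _)); last lra.
  rewrite ler_pdivrMr; last lra.
  rewrite normrM gtr0_norm //.
  apply: (@le_trans _ _ (dl * (dl / 2))); first by rewrite ler_pM2l.
  by lra.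
have k0 : 0 <= 4 / dl ^+ 2 - 1.
  by rewrite subr_ge0 ler_pdivlMr ?exprn_gt0 //; lra.
have sE : - (2 / dl) * y + (4 / dl ^+ 2 - 1) * v = slope dl c * y.
  by rewrite /v /slope; field; rewrite !gt_eqF //=; lra.
move: hv; rewrite ler_norml => /andP[v1 v2].
have lnle : ln (1 + v) <= v by apply: le_ln1Dx; lra.
have lnge : v - v ^+ 2 <= ln (1 + v) by apply: ln1D_ge; apply/andP; split; lra.
apply/andP; split.
  apply: le_trans (expR_ge1Dx _).
  have h1 : (4 / dl ^+ 2 - 1) * (v - v ^+ 2) <= (4 / dl ^+ 2 - 1) * ln (1 + v).
    exact: ler_wpM2l.
  suff h2 : (4 / dl ^+ 2 - 1) * v ^+ 2 <= 4 * y ^+ 2 by lra.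
  apply: (@le_trans _ _ (4 / dl ^+ 2 * v ^+ 2)).
    by apply: ler_wpM2r; [exact: sqr_ge0|lra].
  have -> : 4 / dl ^+ 2 * v ^+ 2 = 4 * y ^+ 2 / (2 + dl * c) ^+ 2.
    by rewrite /v; field; rewrite !gt_eqF //=; lra.
  rewrite ler_pdivrMr; last by apply: exprn_gt0; lra.
  apply: ler_peMr; first by rewrite mulr_ge0 ?sqr_ge0.
  by apply: exprn_ege1.
apply: (@le_trans _ _ (expR (slope dl c * y))).
  rewrite ler_expR -sE lerD2l; exact: ler_wpM2l.
apply: expR_le_quadratic; exact: le_trans (ler_norm _) s1.
Qed.

(** The factor [expR (a ^+ 2 / 2)] is the price for normalizing at [a] instead of
    at the mode; it is the origin of the exponentials in the final estimate. *)
Lemma density_gauss dl a mu c : 0 < dl -> 0 < a -> dl * a <= 1 -> 0 < mu ->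
  - dl^-1 <= c -> c <= a ->
  density dl a mu c <=
  density dl a mu a * (3 * expR (a ^+ 2 / 2 - c ^+ 2 / 4)).
Proof.
move=> dl0 a0 da1 mu0 hc ca.
have i0 : 0 < dl^-1 by rewrite invr_gt0.
have hc3 := one_le_2Dmul dl0 hc.
have hda : dl * c <= dl * a by rewrite ler_pM2l.
have da0 : 0 < dl * a by exact: mulr_gt0.
have ha : - dl^-1 <= a by lra.
rewrite !density_mid //.
have pc : mid_potential dl c <= - (c ^+ 2 / 4) by apply: mid_potential_le => //; lra.
have pa : - (a ^+ 2 / 2) <= mid_potential dl a by apply: mid_potential_ge => //; lra.
have e1 : expR (mid_potential dl c) <=
    expR (mid_potential dl a) * expR (a ^+ 2 / 2 - c ^+ 2 / 4).
  by rewrite -expRD ler_expR; lra.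
set e := expR (a ^+ 2 / 2 - c ^+ 2 / 4) in e1 *.
rewrite !invfM -!mulrA ler_pM2l ?invr_gt0 //.
apply: (@le_trans _ _ (expR (mid_potential dl c))).
  by rewrite ler_piMl ?expR_ge0 // invf_le1 //; lra.
apply: le_trans e1 _.
rewrite mulrCA ler_pM2l ?expR_gt0 // mulrA ler_peMl ?expR_ge0 //.
by rewrite mulrC ler_pdivlMr; lra.
Qed.

End LocalDensityBounds.


(** * Masses and densities on the grid *)

Section PoissonRatio.
Context {R : realType}.
Implicit Types (dl a mu x y z w : R) (n k j : nat).

(** The state [k] on the diffusion scale, when the offered load is [dl ^- 2]. *)
Definition grid dl k : R := dl * k%:R - dl^-1.

(** The ratio of the stationary masses at [k] and at [n], for [k <= n]. *)
Definition mass_ratio dl n k : R := \prod_(k <= j < n) (dl ^+ 2 * j.+1%:R).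

Lemma mul_grid dl k : 0 < dl -> dl * grid dl k = dl ^+ 2 * k%:R - 1.
Proof.
by move=> dl0; rewrite /grid mulrBr divff ?gt_eqF // mulrA -expr2.
Qed.

Lemma gridS dl k : grid dl k.+1 = grid dl k + dl.
Proof. by rewrite /grid -natr1; ring. Qed.

Lemma grid_ge dl k : 0 < dl -> - dl^-1 <= grid dl k.
Proof. by move=> dl0; rewrite /grid lerDr mulr_ge0 // ltW. Qed.

Lemma ler_grid dl k j : 0 < dl -> (k <= j)%N -> grid dl k <= grid dl j.
Proof.
by move=> dl0 kj; rewrite /grid lerD2r ler_pM2l // ler_nat.
Qed.

Lemma mass_ratio_nn dl n : mass_ratio dl n n = 1.
Proof. by rewrite /mass_ratio big_geq. Qed.

Lemma mass_ratioS dl n k : (k < n)%N ->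
  mass_ratio dl n k = dl ^+ 2 * k.+1%:R * mass_ratio dl n k.+1.
Proof. by move=> kn; rewrite /mass_ratio big_ltn. Qed.

Lemma mass_ratio_gt0 dl n k : 0 < dl -> 0 < mass_ratio dl n k.
Proof.
by move=> dl0; apply: prodr_gt0 => j _; rewrite mulr_gt0 ?exprn_gt0.
Qed.

Lemma down_ind n (P : nat -> Prop) : P n ->
  (forall k, (k < n)%N -> P k.+1 -> P k) -> forall k, (k <= n)%N -> P k.
Proof.
move=> Pn IH k kn; rewrite -(subKn kn).
elim: (n - k)%N (leq_subr k n) => [_|m IHm mn]; first by rewrite subn0.
apply: IH; first by rewrite ltn_subrL /= (leq_ltn_trans _ mn).
by rewrite subnSK //; apply: IHm; exact: ltnW.
Qed.

(** One step multiplies the mass ratio by [1 + dl * grid dl k.+1], which is at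
    most the exponential of [dl * grid dl k.+1]; up to [dl ^+ 2 / 2] this is
    the increment of half the square along the grid. *)
Lemma mass_ratio_exp dl n k : 0 < dl -> (k <= n)%N ->
  mass_ratio dl n k <=
  expR ((grid dl n ^+ 2 - grid dl k ^+ 2) / 2 + dl * (grid dl n - grid dl k) / 2).
Proof.
move=> dl0; move: k; apply: down_ind.
  by rewrite mass_ratio_nn !subrr mulr0 !mul0r addr0 expR0.
move=> k kn IH; rewrite mass_ratioS //.
have e1 : dl ^+ 2 * k.+1%:R <= expR (dl * grid dl k.+1).
  by apply: le_trans (expR_ge1Dx _); rewrite mul_grid //; lra.
have h0 : 0 <= dl ^+ 2 * k.+1%:R by rewrite mulr_ge0 // ltW // exprn_gt0.
apply: le_trans (ler_pM h0 (ltW (mass_ratio_gt0 _ _ dl0)) e1 IH) _.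
rewrite -expRD ler_expR gridS; nra.
Qed.

Lemma mass_ratio_gauss dl n k : 0 < dl -> dl ^+ 2 <= 2 ->
  0 < grid dl n -> dl * grid dl n <= 1 -> (k <= n)%N ->
  mass_ratio dl n k <= 4 * expR (grid dl n ^+ 2 / 2 - grid dl k ^+ 2 / 4).
Proof.
move=> dl0 dl2 a0 da kn; apply: le_trans (mass_ratio_exp dl0 kn) _.
have e1 : expR 1 <= 4 :> R by have := @expR_le_quadratic R 1 (lexx _); lra.
set x := grid dl k; set a := grid dl n in a0 da *.
apply: (@le_trans _ _ (expR 1 * expR (a ^+ 2 / 2 - x ^+ 2 / 4))).
  rewrite -expRD ler_expR.
  have := sqr_ge0 (x + dl); nra.
by rewrite ler_pM2r ?expR_gt0.
Qed.

(** The logarithm of the ratio between the density increment and the mass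
    increment over one step of the grid. *)
Definition log_defect dl j : R :=
  2 + (4 / dl ^+ 2 - 1) * ln ((2 + dl * grid dl j) / (2 + dl * grid dl j.+1))
  - ln (dl ^+ 2 * j.+1%:R).

Lemma density_mass_ratio dl mu n k : 0 < dl -> 0 < mu -> (k <= n)%N ->
  density dl (grid dl n) mu (grid dl k) =
  density dl (grid dl n) mu (grid dl n) *
    (mass_ratio dl n k * expR (\sum_(k <= j < n) log_defect dl j)).
Proof.
move=> dl0 mu0; move: k; apply: down_ind.
  by rewrite mass_ratio_nn big_geq // expR0 !mulr1.
move=> k kn IH.
rewrite (@density_ratio _ dl _ mu (grid dl k.+1) (grid dl k)) //; first last.
- by apply: ler_grid => //; exact: ltnW.
- exact: grid_ge.
- exact: ler_grid.
- exact: grid_ge.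
rewrite IH (mass_ratioS _ kn) (big_ltn kn) expRD.
have p0 : 0 < dl ^+ 2 * k.+1%:R by rewrite mulr_gt0 ?exprn_gt0.
have -> : - (2 / dl) * (grid dl k - grid dl k.+1) +
   (4 / dl ^+ 2 - 1) * ln ((2 + dl * grid dl k) / (2 + dl * grid dl k.+1)) =
   log_defect dl k + ln (dl ^+ 2 * k.+1%:R).
  rewrite /log_defect addrNK gridS; congr (_ + _).
  by field; rewrite gt_eqF.
by rewrite expRD lnK ?posrE //; ring.
Qed.

(** With [w = dl * grid dl j.+1], both logarithms in [log_defect] are expanded
    in odd powers, as in [ln_ge1_bounds]; the leading terms cancel up to
    [dl ^+ 2 * w], and the cubic remainders make up the rest of the bound. *)
Lemma log_defect_le dl j : 0 < dl -> dl ^+ 2 <= 2 ->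
  - (1 / 2) <= dl * grid dl j.+1 -> dl * grid dl j.+1 <= 1 ->
  `|log_defect dl j| <= dl ^+ 2 * `|dl * grid dl j.+1| + (dl ^+ 2) ^+ 2
     + 2 * `|dl * grid dl j.+1| ^+ 3.
Proof.
move=> dl0 dl2 w1 w2.
have q0 : 0 < dl ^+ 2 by rewrite exprn_gt0.
have qE : dl ^+ 2 * j.+1%:R = 1 + dl * grid dl j.+1 by rewrite mul_grid //; lra.
have jE : 2 + dl * grid dl j = 2 + dl * grid dl j.+1 - dl ^+ 2.
  by rewrite gridS; ring.
have W1 : 1 + dl ^+ 2 <= 2 + dl * grid dl j.+1.
  rewrite mul_grid //.
  have : dl ^+ 2 * 1 <= dl ^+ 2 * j.+1%:R by rewrite ler_pM2l // ler1n.
  lra.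
rewrite /log_defect qE jE.
move: (dl * grid dl j.+1) w1 w2 W1 {qE jE} => w w1 w2 W1.
move: (dl ^+ 2) q0 dl2 W1 => q q0 q2 W1.
set W := 2 + w in W1 *.
have W0 : 0 < W by lra.
have lnE : ln ((W - q) / W) = - ln (W / (W - q)).
  by rewrite -invf_div lnV // posrE divr_gt0 //; lra.
have hx : 1 <= W / (W - q) <= 3.
  by apply/andP; split; rewrite ?ler_pdivlMr ?ler_pdivrMr; lra.
have := ln_ge1_bounds hx.
have -> : (W / (W - q) - 1) / (W / (W - q) + 1) = q / (2 * W - q).
  by field; rewrite !gt_eqF //=; lra.
rewrite lnE; set L := ln (W / (W - q)); move=> /andP[L1 L2].
pose y := q / (2 * W - q).
have lnw : `|ln (1 + w) - 2 * (w / W)| <= 2 * `|w| ^+ 3.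
  have wW : `|w / W| <= `|w|.
    rewrite normrM normfV (gtr0_norm W0) ler_piMr // invf_le1 //; lra.
  have wW3 : `|w / W| ^+ 3 <= `|w| ^+ 3 by rewrite lerXn2r ?nnegrE.
  have E : (1 + w - 1) / (1 + w + 1) = w / W.
    by rewrite /W; congr (_ / _); lra.
  have [w0|w0] := leP 0 w.
    have hw : 1 <= 1 + w <= 3 by apply/andP; split; lra.
    have := ln_ge1_bounds hw; rewrite E => /andP[h1 h2].
    have wW0 : 0 <= w / W by rewrite divr_ge0 // ltW.
    rewrite (ger0_norm wW0) in wW3.
    by rewrite ger0_norm; lra.
  have hw : 1 / 3 <= 1 + w <= 1 by apply/andP; split; lra.
  have := ln_le1_bounds hw; rewrite E => /andP[h1 h2].
  have wW0 : w / W <= 0 by rewrite ler_pdivrMr // mul0r ltW.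
  rewrite (ler0_norm wW0) exprNn in wW3.
  rewrite ler0_norm; lra.
have yb : 0 <= (4 / q - 1) * (L - 2 * y) <= q ^+ 2.
  have k0 : 0 <= 4 / q - 1 by rewrite subr_ge0 ler_pdivlMr //; lra.
  have y0 : 0 <= y by rewrite /y divr_ge0 //; lra.
  have yq : y <= q / 2.
    by rewrite /y ler_pM2l // lef_pV2 ?posrE //; lra.
  apply/andP; split; first by apply: mulr_ge0 => //; rewrite /y; lra.
  apply: (@le_trans _ _ (4 / q * (2 * y ^+ 3))).
    apply: ler_pM => //; rewrite /y; lra.
  apply: (@le_trans _ _ (4 / q * (2 * (q / 2) ^+ 3))).
    rewrite ler_pM2l ?divr_gt0 // ler_pM2l // lerXn2r ?nnegrE //; lra.
  by rewrite le_eqVlt; apply/orP; left; apply/eqP; field; rewrite gt_eqF.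
have main : `|2 - (4 / q - 1) * (2 * y) - 2 * (w / W)| <= q * `|w|.
  have -> : 2 - (4 / q - 1) * (2 * y) - 2 * (w / W) =
      (q * w) * (2 / (W * (2 * W - q))).
    by rewrite /y /W; field; rewrite !gt_eqF //= -/W; lra.
  rewrite normrM (@ger0_norm _ (2 / _)); last first.
    by rewrite divr_ge0 // mulr_ge0 //; lra.
  rewrite normrM (gtr0_norm q0) ler_piMr ?mulr_ge0 // ?(ltW q0) //.
  by rewrite ler_pdivrMr ?mulr_gt0 //; [nra|lra].
move: main lnw yb; rewrite !ler_norml => /andP[m1 m2] /andP[l1 l2] /andP[y1 y2].
apply/andP; split; lra.
Qed.

(** If [m] bounds the grid points between [k] and [n], there are at most
    [m / dl] steps, and the defect of each step is of order [dl ^+ 3]. *)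
Lemma sum_log_defect_le dl n k : 0 < dl -> dl ^+ 2 <= 2 ->
  0 < grid dl n -> dl * grid dl n <= 1 -> (k <= n)%N ->
  - (1 / 2) <= dl * grid dl k ->
  `|\sum_(k <= j < n) log_defect dl j| <=
  24 * dl ^+ 2 * ((1 + grid dl n ^+ 4) * (1 + grid dl k ^+ 4)).
Proof.
move=> dl0 dl2 a0 da1 kn wk.
set a := grid dl n in a0 da1 *; set x := grid dl k in wk *.
pose m := `|x| + a.
have m0 : 0 <= m by rewrite addr_ge0 // ltW.
pose B := dl ^+ 2 * (dl * m) + (dl ^+ 2) ^+ 2 + 2 * (dl * m) ^+ 3.
have le1 j : (k <= j < n)%N -> `|log_defect dl j| <= B.
  move=> /andP[kj jn].
  have g1 : x <= grid dl j.+1 by apply: ler_grid => //; exact: leqW.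
  have g2 : grid dl j.+1 <= a by exact: ler_grid.
  have h1 : dl * x <= dl * grid dl j.+1 by rewrite ler_pM2l.
  have h2 : dl * grid dl j.+1 <= dl * a by rewrite ler_pM2l.
  have h3 : `|dl * grid dl j.+1| <= dl * m.
    rewrite normrM gtr0_norm // ler_pM2l // /m ler_norml.
    have := ler_norm x; have := ler_norm (- x); rewrite normrN => x1 x2.
    by apply/andP; split; lra.
  apply: le_trans (log_defect_le dl0 dl2 _ _) _; try lra.
  have h4 : dl ^+ 2 * `|dl * grid dl j.+1| <= dl ^+ 2 * (dl * m).
    by rewrite ler_pM2l ?exprn_gt0.
  have h5 : `|dl * grid dl j.+1| ^+ 3 <= (dl * m) ^+ 3.
    by rewrite lerXn2r ?nnegrE // mulr_ge0 // ltW.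
  by rewrite /B; lra.
have B0 : 0 <= B.
  have dm : 0 <= dl * m by exact: mulr_ge0 (ltW dl0) m0.
  have := exprn_ge0 3 dm; have := sqr_ge0 (dl ^+ 2).
  by have := mulr_ge0 (sqr_ge0 dl) dm; rewrite /B; lra.
have s1 : `|\sum_(k <= j < n) log_defect dl j| <= (n - k)%:R * B.
  apply: le_trans (ler_norm_sum _ _ _) _.
  rewrite big_nat_cond.
  apply: (@le_trans _ _ (\sum_(k <= j < n | (k <= j < n)%N && true) B)).
    by apply: ler_sum => j /andP[/le1].
  by rewrite -big_nat_cond sumr_const_nat mulr_natl.
have nk : (n - k)%:R * dl = a - x by rewrite natrB // /a /x /grid; ring.
have nkm : (n - k)%:R * dl <= m.
  rewrite nk /m; have := ler_norm (- x); rewrite normrN; lra.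
apply: le_trans s1 _.
have -> : (n - k)%:R * B =
   (n - k)%:R * dl * (dl ^+ 2 * (m + dl + 2 * m ^+ 3)).
  by rewrite /B; ring.
apply: (@le_trans _ _ (m * (dl ^+ 2 * (m + dl + 2 * m ^+ 3)))).
  apply: ler_wpM2r => //; apply: mulr_ge0; first exact: sqr_ge0.
  have := exprn_ge0 3 m0; lra.
rewrite mulrCA -[24 * _]mulrC -[leRHS]mulrA ler_pM2l ?exprn_gt0 //.
have m4 : m ^+ 4 <= 8 * (a ^+ 4 + x ^+ 4).
  have x4 : x ^+ 4 = `|x| ^+ 4 by rewrite -normrX ger0_norm // exprn_even_ge0.
  rewrite x4 /m; move: (`|x|) => t.
  have : 0 <= (a - t) ^+ 2 * (7 * a ^+ 2 + 10 * (a * t) + 7 * t ^+ 2).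
    apply: mulr_ge0; first exact: sqr_ge0.
    have := sqr_ge0 (a + t); have := sqr_ge0 a; have := sqr_ge0 t; nra.
  lra.
have ax : 0 <= a ^+ 4 * x ^+ 4.
  by rewrite mulr_ge0 // exprn_even_ge0.
have : m * (m + dl + 2 * m ^+ 3) <= 2 + 3 * m ^+ 4.
  have := sqr_ge0 (m - dl); have := sqr_ge0 (m ^+ 2 - 1); nra.
lra.
Qed.

Lemma sub_le_ln_ratio (A B D : R) : 0 < B -> A = B * expR D ->
  `|A - B| <= `|D| * (A + B).
Proof.
move=> B0 ->; have E0 := expR_gt0 D.
have [D0|D0] := leP 0 D.
  have h := one_sub_expRN_le D.
  rewrite expRN in h.
  have h2 : expR D - 1 <= D * expR D.
    rewrite -(@ler_pM2r _ (expR D)^-1) ?invr_gt0 // mulrBl mul1r.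
    by rewrite -mulrA divff ?gt_eqF // mulr1.
  rewrite ger0_norm; last first.
    by rewrite subr_ge0 ler_peMr ?(ltW B0) // -expR0 ler_expR.
  rewrite (ger0_norm D0).
  have := ler_wpM2l (ltW B0) h2; have := mulr_ge0 D0 (ltW B0); lra.
have h := expR_ge1Dx D.
rewrite ltr0_norm ?(ltr0_norm D0).
  have := ler_wpM2l (ltW B0) h.
  have DB : D * (B * expR D) <= 0 by rewrite nmulr_rle0 ?mulr_ge0 ?(ltW B0) ?(ltW E0).
  lra.
by rewrite subr_lt0 gtr_pMr // expR_lt1.
Qed.

(** On the far left the logarithms are not under control, but there
    [dl * grid dl k] is bounded away from zero, so the weight
    [dl ^+ 2 * (1 + grid dl k ^+ 4)] absorbs the trivial bound. *)
Lemma density_sub_mass dl mu n k : 0 < dl -> dl ^+ 2 <= 2 -> 0 < mu ->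
  0 < grid dl n -> dl * grid dl n <= 1 -> (k <= n)%N ->
  let A := density dl (grid dl n) mu (grid dl k) /
           density dl (grid dl n) mu (grid dl n) in
  `|A - mass_ratio dl n k| <=
  24 * dl ^+ 2 * ((1 + grid dl n ^+ 4) * (1 + grid dl k ^+ 4)) *
    (A + mass_ratio dl n k).
Proof.
move=> dl0 dl2 mu0 a0 da1 kn; lazy zeta.
set A := density _ _ _ _ / _.
have f0 x : 0 < density dl (grid dl n) mu x by exact: density_gt0.
have A0 : 0 < A by exact: divr_gt0.
have B0 := mass_ratio_gt0 n k dl0.
have [wk|wk] := leP (- (1 / 2)) (dl * grid dl k).
  have AE : A = mass_ratio dl n k * expR (\sum_(k <= j < n) log_defect dl j).
    rewrite /A density_mass_ratio // mulrC mulKf // gt_eqF //.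
  apply: le_trans (sub_le_ln_ratio B0 AE) _.
  by rewrite ler_pM2r; [exact: sum_log_defect_le|exact: addr_gt0].
apply: (@le_trans _ _ (A + mass_ratio dl n k)).
  by rewrite ler_norml; apply/andP; split; lra.
rewrite ler_peMl //; first by rewrite ltW // addr_gt0.
set x := grid dl k in wk *; set a := grid dl n.
have a4 : 0 <= a ^+ 4 by rewrite exprn_even_ge0.
have x2 := sqr_ge0 (x ^+ 2 - 1).
have w2 : 1 <= 4 * (dl ^+ 2 * x ^+ 2) by nra.
have q0 : 0 < dl ^+ 2 by rewrite exprn_gt0.
have x3 : x ^+ 2 <= 1 + x ^+ 4 by have := sqr_ge0 (x ^+ 2); nra.
have x4 : dl ^+ 2 * x ^+ 2 <= dl ^+ 2 * (1 + x ^+ 4) by rewrite ler_pM2l.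
have x5 : 0 <= dl ^+ 2 * (a ^+ 4 * (1 + x ^+ 4)).
  apply: mulr_ge0 (ltW q0) _; apply: mulr_ge0 => //.
  have : 0 <= x ^+ 4 by rewrite exprn_even_ge0.
  lra.
lra.
Qed.

End PoissonRatio.


(** * Sums over the grid *)

Section GridSums.
Context {R : realType}.
Implicit Types (dl a c x : R) (n k j : nat).

Definition sigmoid x : R := x / (1 + `|x|).

Lemma sigmoid_itv x : - 1 <= sigmoid x <= 1.
Proof.
have h : 0 < 1 + `|x| by rewrite ltr_pwDl.
have := ler_norm x; have := ler_norm (- x); rewrite normrN => h1 h2.
by rewrite /sigmoid ler_pdivlMr // ler_pdivrMr //; apply/andP; split; lra.
Qed.

(** The increments of the bounded function [sigmoid] dominate
    [dl / (1 + x ^+ 2)], so that sums over the grid telescope. *)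
Lemma sigmoid_increment dl x : 0 < dl -> dl ^+ 2 <= 2 ->
  dl / (1 + x ^+ 2) <= 6 * (sigmoid (x + dl) - sigmoid x).
Proof.
move=> dl0 dl2.
have dl3 : dl <= 3 / 2 by nra.
have x2 : 0 < 1 + x ^+ 2 by rewrite ltr_pwDl ?sqr_ge0.
rewrite ler_pdivrMr // /sigmoid.
have [x0|x0] := leP 0 x.
  rewrite ger0_norm ?ger0_norm //; last lra.
  have -> : (x + dl) / (1 + (x + dl)) - x / (1 + x) =
      dl / ((1 + x) * (1 + (x + dl))).
    by field; rewrite !gt_eqF //=; lra.
  have P0 : 0 < (1 + x) * (1 + (x + dl)) by apply: mulr_gt0; lra.
  have -> : 6 * (dl / ((1 + x) * (1 + (x + dl)))) * (1 + x ^+ 2) =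
     dl * ((6 * (1 + x ^+ 2)) / ((1 + x) * (1 + (x + dl)))) by ring.
  rewrite ler_peMr ?(ltW dl0) // ler_pdivlMr // mul1r; nra.
rewrite (ltr0_norm x0).
have [y0|y0] := leP 0 (x + dl).
  rewrite ger0_norm //.
  have h1 : (x + dl) / (1 + dl) <= (x + dl) / (1 + (x + dl)).
    by apply: ler_wpM2l => //; rewrite lef_pV2 ?posrE; lra.
  have h2 : - x / (1 + dl) <= - x / (1 - x).
    by apply: ler_wpM2l; [lra|rewrite lef_pV2 ?posrE; lra].
  have h3 : dl / (5 / 2) <= dl / (1 + dl).
    by rewrite ler_pM2l // lef_pV2 ?posrE; lra.
  have h4 : dl / (1 + dl) = (x + dl) / (1 + dl) + - x / (1 + dl).
    by rewrite -mulrDl; congr (_ / _); ring.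
  have h5 : dl <= 6 * ((x + dl) / (1 + (x + dl)) - x / (1 - x)).
    move: h1 h2 h3; rewrite h4 !mulNr; lra.
  apply: (le_trans h5); rewrite ler_peMr //; last by rewrite lerDl sqr_ge0.
  exact: le_trans (ltW dl0) h5.
rewrite ltr0_norm //.
have -> : (x + dl) / (1 - (x + dl)) - x / (1 - x) =
    dl / ((1 - x) * (1 - (x + dl))).
  by field; rewrite !gt_eqF //=; lra.
have P0 : 0 < (1 - x) * (1 - (x + dl)) by apply: mulr_gt0; lra.
have -> : 6 * (dl / ((1 - x) * (1 - (x + dl)))) * (1 + x ^+ 2) =
   dl * ((6 * (1 + x ^+ 2)) / ((1 - x) * (1 - (x + dl)))) by ring.
rewrite ler_peMr ?(ltW dl0) // ler_pdivlMr // mul1r; nra.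
Qed.

Lemma sum_grid_reciprocal dl m n : 0 < dl -> dl ^+ 2 <= 2 -> (m <= n)%N ->
  \sum_(m <= k < n) (1 + grid dl k ^+ 2)^-1 <= 12 / dl.
Proof.
move=> dl0 dl2 mn; rewrite ler_pdivlMr // mulr_suml.
apply: (@le_trans _ _ (\sum_(m <= k < n)
    (6 * sigmoid (grid dl k.+1) - 6 * sigmoid (grid dl k)))).
  apply: ler_sum => k _; rewrite mulrC gridS -mulrBr.
  exact: sigmoid_increment.
rewrite (telescope_sumr (fun k => 6 * sigmoid (grid dl k)) mn).
have /andP[h1 h2] := sigmoid_itv (grid dl n).
have /andP[h3 h4] := sigmoid_itv (grid dl m).
lra.
Qed.

Lemma quartic_gauss_le x :
  (1 + x ^+ 4) * expR (- (x ^+ 2 / 4)) <= 1152 / (1 + x ^+ 2).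
Proof.
have x2 : 0 < 1 + x ^+ 2 by rewrite ltr_pwDl ?sqr_ge0.
rewrite expRN ler_pdivlMr // mulrAC ler_pdivrMr ?expR_gt0 //.
have h : 0 <= x ^+ 2 / 4 by rewrite divr_ge0 ?sqr_ge0.
have := expR_ge1Dxn 2 h; rewrite (_ : 3`! = 6)%N // => e.
have c0 : 0 <= 1152 :> R by rewrite ler0n.
apply: le_trans (ler_wpM2l c0 e).
move: (sqr_ge0 x); rewrite (_ : x ^+ 4 = (x ^+ 2) ^+ 2); last by rewrite -exprM.
move: (x ^+ 2) => t t0.
have := mulr_ge0 t0 (sqr_ge0 (t - 1)); have := sqr_ge0 (t - 1).
have : 0 <= (t + 1) * (t - 1) ^+ 2 by apply: mulr_ge0; [lra|exact: sqr_ge0].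
have := exprn_ge0 3 t0.
lra.
Qed.

Lemma quartic_le_gauss a : 1 + a ^+ 4 <= 8 * expR (a ^+ 2 / 2).
Proof.
have h : 0 <= a ^+ 2 / 2 by rewrite divr_ge0 ?sqr_ge0.
have := expR_ge1Dxn 1 h; rewrite (_ : 2`! = 2)%N //.
have : 0 <= a ^+ 4 by rewrite exprn_even_ge0.
lra.
Qed.

Lemma expRN_inv_sqr_le dl : 0 < dl -> expR (- (dl^-1 ^+ 2 / 4)) <= 4 * dl ^+ 2.
Proof.
move=> dl0; have h := expR_ge1Dx (dl^-1 ^+ 2 / 4).
have h2 : dl^-1 ^+ 2 / 4 <= expR (dl^-1 ^+ 2 / 4) by lra.
rewrite expRN -[leRHS]invrK lef_pV2 ?posrE ?expR_gt0 ?invr_gt0 //; last first.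
  by rewrite mulr_gt0 // exprn_gt0.
by move: h2; rewrite invfM exprVn mulrC.
Qed.

End GridSums.


(** * Integrals over cells *)

Section MillsRatio.
Context {R : realType}.
Notation leb := (@lebesgue_measure R).
Implicit Types (dl a mu c x : R) (n k j : nat).

Lemma integral_cell dl mu n k : 0 < dl -> dl ^+ 2 <= 2 -> 0 < mu ->
  0 < grid dl n -> (1 <= k < n)%N ->
  let a := grid dl n in let c := grid dl k in let f := density dl a mu in
  `|\int[leb]_(x in `[c - dl / 2, c + dl / 2]) f x - dl * f c| <=
  2 * dl ^+ 3 * (1 + c ^+ 2) * f c.
Proof.
move=> dl0 dl2 mu0 a0 /andP[k1 kn]; lazy zeta.
set a := grid dl n in a0 *; set c := grid dl k; set f := density dl a mu.
have h0 : 0 <= dl / 2 by rewrite divr_ge0 // ltW.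
have fc : 0 < f c by exact: density_gt0.
have fi : leb.-integrable `[c - dl / 2, c + dl / 2] (EFin \o f).
  by apply: integrable_continuous_itvcc => x _; exact: continuous_density.
have c1 : - dl^-1 + dl <= c.
  rewrite /c /grid addrC lerD2r -[leLHS]mulr1 ler_pM2l // ler1n //.
have ca : c + dl <= a by rewrite /c /a -gridS; exact: ler_grid.
have key y : `|y| <= dl / 2 ->
    f c * (1 + slope dl c * y - 4 * y ^+ 2) <= f (c + y) <=
    f c * (1 + slope dl c * y + 2 * (slope dl c * y) ^+ 2).
  move=> hy; apply: density_cell => //; first by lra.
  by move: hy; rewrite ler_norml => /andP[]; lra.
have up : \int[leb]_(x in `[c - dl / 2, c + dl / 2]) f x <=
    2 * (dl / 2) * f c + 2 / 3 * (dl / 2) ^+ 3 * (2 * f c * slope dl c ^+ 2).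
  apply: (@Rintegral_le_quadratic _ f _ (f c * slope dl c)) => // y /key /andP[_ h].
  apply: le_trans h _; rewrite le_eqVlt; apply/orP; left; apply/eqP; ring.
have lo : 2 * (dl / 2) * f c + 2 / 3 * (dl / 2) ^+ 3 * (- 4 * f c) <=
    \int[leb]_(x in `[c - dl / 2, c + dl / 2]) f x.
  apply: (@Rintegral_ge_quadratic _ f _ (f c * slope dl c)) => // y /key /andP[h _].
  apply: le_trans h; rewrite le_eqVlt; apply/orP; left; apply/eqP; ring.
have s2 : slope dl c ^+ 2 <= 8 * c ^+ 2 + 4.
  have hc : - dl^-1 <= c by exact: grid_ge.
  have h := slope_le dl0 hc.
  have h2 : `|slope dl c| ^+ 2 <= (2 * `|c| + dl) ^+ 2.
    by rewrite lerXn2r ?nnegrE // addr_ge0 ?mulr_ge0 // ltW.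
  rewrite real_normK ?num_real // in h2.
  have h3 : `|c| ^+ 2 = c ^+ 2 by rewrite real_normK ?num_real.
  have := sqr_ge0 (2 * `|c| - dl); lra.
have d3 : 0 < dl ^+ 3 * f c by rewrite mulr_gt0 // exprn_gt0.
have s3 := ler_wpM2l (ltW d3) s2.
have s4 : 0 <= dl ^+ 3 * f c * c ^+ 2 by rewrite mulr_ge0 ?sqr_ge0 // ltW.
rewrite ler_norml; apply/andP; split; lra.
Qed.

Lemma integral_half_cell dl mu n : 0 < dl -> dl ^+ 2 <= 2 -> 0 < mu ->
  (0 < n)%N -> 0 < grid dl n ->
  let a := grid dl n in let f := density dl a mu in
  `|\int[leb]_(x in `[a - dl / 2, a]) f x - dl / 2 * f a| <=
  dl / 2 * f a * (5 * dl * (1 + a)).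
Proof.
move=> dl0 dl2 mu0 n0 a0; lazy zeta.
set a := grid dl n in a0 *; set f := density dl a mu.
have dl3 : dl <= 3 / 2 by nra.
have fa : 0 < f a by exact: density_gt0.
have hc : - dl^-1 <= a by exact: grid_ge.
have c1 : - dl^-1 + dl <= a.
  by rewrite /a /grid addrC lerD2r -[leLHS]mulr1 ler_pM2l // ler1n.
pose c := a - dl / 4; pose h := dl / 4.
have h0 : 0 <= h by rewrite divr_ge0 // ltW.
have itvE : `[a - dl / 2, a] = `[c - h, c + h] %R :> interval R.
  by congr (Interval (BLeft _) (BRight _)); rewrite /c /h; lra.
have fi : leb.-integrable `[c - h, c + h] (EFin \o f).
  by apply: integrable_continuous_itvcc => x _; exact: continuous_density.
set K := 5 * dl * (1 + a).
have key y : `|y| <= h -> f a * (1 - K) <= f (c + y) <= f a * (1 + K).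
  rewrite ler_norml => /andP[y1 y2].
  pose t := y - dl / 4.
  have t0 : t <= 0 by rewrite /t /h in y1 y2 *; lra.
  have t1 : `|t| <= dl / 2.
    by rewrite ler_norml; apply/andP; split; rewrite /t /h in y1 y2 *; lra.
  have -> : c + y = a + t by rewrite /c /t; ring.
  have at1 : a + t <= a by lra.
  have /andP[k1 k2] := @density_cell _ dl a mu a t dl0 dl2 mu0 c1 (lexx _) at1 t1.
  have s1 := slope_mul_le1 dl0 dl2 hc t1.
  have s2 : `|slope dl a * t| <= (2 * a + dl) * (dl / 2).
    rewrite normrM; apply: ler_pM => //.
    by have := slope_le dl0 hc; rewrite (gtr0_norm a0).
  have s3 : (slope dl a * t) ^+ 2 <= `|slope dl a * t|.
    rewrite -[leLHS]ger0_norm ?sqr_ge0 // normrX expr2.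
    by apply: ler_piMr.
  have t2 : t ^+ 2 <= (dl / 2) ^+ 2.
    by rewrite -[leLHS]ger0_norm ?sqr_ge0 // normrX lerXn2r ?nnegrE //; lra.
  have s4 := ler_norm (slope dl a * t).
  have s5 := ler_norm (- (slope dl a * t)); rewrite normrN in s5.
  have da : 0 < dl * a by exact: mulr_gt0.
  have d2 : dl ^+ 2 <= 3 / 2 * dl by nra.
  apply/andP; split.
    by apply: le_trans k1; rewrite ler_pM2l // /K; lra.
  by apply: le_trans k2 _; rewrite ler_pM2l // /K; lra.
have up : \int[leb]_(x in `[c - h, c + h]) f x <=
    2 * h * (f a * (1 + K)) + 2 / 3 * h ^+ 3 * 0.
  apply: (@Rintegral_le_quadratic _ f _ 0) => // y /key /andP[_].
  by rewrite !mul0r !addr0.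
have lo : 2 * h * (f a * (1 - K)) + 2 / 3 * h ^+ 3 * 0 <=
    \int[leb]_(x in `[c - h, c + h]) f x.
  apply: (@Rintegral_ge_quadratic _ f _ 0) => // y /key /andP[+ _].
  by rewrite !mul0r !addr0.
rewrite itvE ler_norml; move: up lo; rewrite /h => up lo.
by apply/andP; split; lra.
Qed.

(** At [- dl^-1] the Gaussian factor [expR (- (dl^-1 ^+ 2 / 4))] is already of
    order [dl ^+ 2], and further to the left the density decays exponentially
    at rate [2 / dl]. *)
Lemma integral_left_tail dl mu n : 0 < dl -> dl ^+ 2 <= 2 -> 0 < mu ->
  (0 < n)%N -> 0 < grid dl n -> dl * grid dl n <= 1 ->
  let a := grid dl n in let f := density dl a mu in
  leb.-integrable setT (EFin \o f) ->
  \int[leb]_(x in `]-oo, (grid dl 0 + dl / 2)%R]) f x <=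
  dl * f a * (60 * dl * expR (a ^+ 2)).
Proof.
move=> dl0 dl2 mu0 n0 a0 da1; lazy zeta.
set a := grid dl n in a0 da1 *; set f := density dl a mu => fi.
have fiS (i : interval R) : leb.-integrable [set` i] (EFin \o f).
  exact: integrableS fi.
have i0 : 0 < dl^-1 by rewrite invr_gt0.
have fa : 0 < f a by exact: density_gt0.
have dl3 : dl <= 3 / 2 by nra.
have x0E : grid dl 0 = - dl^-1 by rewrite /grid mulr0 sub0r.
have x1a : grid dl 0 + dl <= a by rewrite -gridS; exact: ler_grid.
set x0 := grid dl 0 in x0E x1a *.
pose M := f a * (3 * (expR (a ^+ 2 / 2) * (2 * (4 * dl ^+ 2)))).
have e2 : expR (1 / 4) <= 2 :> R.
  have h1 : 1 / 4 <= 1 :> R by lra.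
  have := expR_le_quadratic h1; lra.
have small := expRN_inv_sqr_le dl0.
have fM x : x0 <= x -> x <= x0 + dl / 2 -> f x <= M.
  move=> h1 h2; have xa : x <= a by lra.
  have hx : - dl^-1 <= x by rewrite -x0E.
  apply: le_trans (density_gauss dl0 a0 da1 mu0 hx xa) _.
  rewrite /M ler_pM2l // ler_pM2l //.
  apply: (@le_trans _ _ (expR (a ^+ 2 / 2) *
      (expR (1 / 4) * expR (- (dl^-1 ^+ 2 / 4))))).
    rewrite -!expRD ler_expR.
    have ii : dl^-1 * dl = 1 by rewrite mulVf ?gt_eqF.
    rewrite x0E in h1 h2; nra.
  rewrite ler_pM2l ?expR_gt0 //.
  by apply: ler_pM => //; exact: expR_ge0.
have M0 : 0 <= M.
  apply: mulr_ge0 (ltW fa) _; apply: mulr_ge0 => //.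
  by apply: mulr_ge0 (expR_ge0 _) _; have := sqr_ge0 dl; lra.
have xx : x0 <= x0 + dl / 2 by rewrite lerDl divr_ge0 // ltW.
rewrite (@Rintegral_itv_cat _ f _ x0) //.
have p1 : \int[leb]_(x in `]-oo, x0]) f x <= M * (2 / dl)^-1.
  have k0 : 0 < 2 / dl by rewrite divr_gt0.
  have mE : measurable_fun (`]-oo, x0] : set R) (fun x => expR (2 / dl * (x - x0))).
    apply: measurable_funTS; apply: continuous_measurable_fun.
    exact: continuous_expR_affine.
  have ie := integral_expR_itvNyc x0 k0.
  have iE := @integrable_ge0 _ _ _ _ (measurable_itv _) mE
    (fun x _ => expR_ge0 _) ie.
  apply: (@le_trans _ _ (\int[leb]_(x in `]-oo, x0])
      (f x0 * expR (2 / dl * (x - x0))))).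
    have iE2 : leb.-integrable `]-oo, x0]
        (EFin \o (fun x => f x0 * expR (2 / dl * (x - x0)))).
      by apply: (integrableZl _ (f x0) iE).
    apply: (le_Rintegral _ (fiS _) iE2) => //.
    move=> x /=; rewrite in_itv /= => xx0.
    rewrite x0E; apply: density_left => //; by rewrite -x0E.
  rewrite RintegralZl // /Rintegral ie /=.
  by rewrite ler_pM2r ?invr_gt0 //; apply: fM.
have p2 : \int[leb]_(x in `[x0, x0 + dl / 2]) f x <= M * (dl / 2).
  pose c := x0 + dl / 4; pose h := dl / 4.
  have itvE : `[x0, x0 + dl / 2] = `[c - h, c + h] %R :> interval R.
    by congr (Interval (BLeft _) (BRight _)); rewrite /c /h; lra.
  rewrite itvE.
  have h0 : 0 <= h by rewrite divr_ge0 // ltW.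
  apply: (@le_trans _ _ (2 * h * M + 2 / 3 * h ^+ 3 * 0)); last by rewrite /h; lra.
  apply: (@Rintegral_le_quadratic _ f _ 0) => // y.
  rewrite ler_norml !mul0r !addr0 => /andP[y1 y2].
  by apply: fM; rewrite /c /h in y1 y2 *; lra.
apply: le_trans (lerD p1 p2) _; rewrite invf_div.
have ee : expR (a ^+ 2 / 2) <= expR (a ^+ 2).
  by rewrite ler_expR; have := sqr_ge0 a; lra.
have dfa : 0 < dl * f a * dl ^+ 2 by rewrite mulr_gt0 ?exprn_gt0 // mulr_gt0.
have d2 : dl ^+ 2 <= 3 / 2 * dl by nra.
apply: (@le_trans _ _ (dl * f a * (24 * dl ^+ 2 * expR (a ^+ 2)))).
  have := ler_wpM2l (ltW dfa) ee; rewrite /M; lra.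
rewrite ler_pM2l; last exact: mulr_gt0.
rewrite ler_pM2r ?expR_gt0 //; lra.
Qed.

End MillsRatio.


(** * The discrete and the continuous Mills ratio *)

Section MillsComparison.
Context {R : realType}.
Notation leb := (@lebesgue_measure R).
Implicit Types (dl a mu c x : R) (n k j : nat).

(** In the constant, [28 = 4 + 24] collects the midpoint rule and
    [density_sub_mass], [7 = 3 + 4] the Gaussian bounds for the density and the
    mass, and [8] and [1152] the quartic weights that the Gaussians absorb. *)
Lemma cell_mass_error dl mu n k : 0 < dl -> dl ^+ 2 <= 2 -> 0 < mu ->
  0 < grid dl n -> dl * grid dl n <= 1 -> (1 <= k < n)%N ->
  let a := grid dl n in let c := grid dl k in let f := density dl a mu in
  `|\int[leb]_(x in `[c - dl / 2, c + dl / 2]) f x -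
    dl * f a * mass_ratio dl n k| <=
  dl * f a * (28 * 7 * 8 * 1152 * dl ^+ 2 * expR (a ^+ 2) * (1 + c ^+ 2)^-1).
Proof.
move=> dl0 dl2 mu0 a0 da1 k1n; lazy zeta.
have kn : (k <= n)%N by case/andP: k1n => _ /ltnW.
have cell := integral_cell dl0 dl2 mu0 a0 k1n.
have AB := density_sub_mass dl0 dl2 mu0 a0 da1 kn.
have B0 := mass_ratio_gt0 n k dl0.
have B4 := mass_ratio_gauss dl0 dl2 a0 da1 kn.
have A3 := density_gauss dl0 a0 da1 mu0 (grid_ge k dl0) (ler_grid dl0 kn).
move: cell AB B4 A3; lazy zeta.
set a := grid dl n in a0 da1 *; set c := grid dl k; set f := density dl a mu.
set I := Rintegral _ _ _; set B := mass_ratio dl n k in B0 *.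
move=> cell AB B4 A3.
have fa : 0 < f a by exact: density_gt0.
have fc : 0 < f c by exact: density_gt0.
set A := f c / f a in AB.
have fcE : f c = f a * A by rewrite /A mulrC divfK // gt_eqF.
have A0 : 0 < A by exact: divr_gt0.
have {}A3 : A <= 3 * expR (a ^+ 2 / 2 - c ^+ 2 / 4).
  by rewrite /A ler_pdivrMr // mulrC.
have q0 : 0 < dl ^+ 2 by rewrite exprn_gt0.
have a4 : 0 <= a ^+ 4 by rewrite exprn_even_ge0.
have c4 : 0 <= c ^+ 4 by rewrite exprn_even_ge0.
have P0 : 0 <= (1 + a ^+ 4) * (1 + c ^+ 4) by apply: mulr_ge0; lra.
have c2 : 1 + c ^+ 2 <= 2 * ((1 + a ^+ 4) * (1 + c ^+ 4)).
  have := sqr_ge0 (c ^+ 2 - 1); have := mulr_ge0 a4 c4; lra.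
have s1 : `|I - dl * f a * B| <=
    dl * f a * (28 * dl ^+ 2 * ((1 + a ^+ 4) * (1 + c ^+ 4)) * (A + B)).
  have -> : I - dl * f a * B = (I - dl * f c) + dl * f a * (A - B).
    by rewrite fcE; ring.
  apply: le_trans (ler_normD _ _) _.
  have dfa : 0 < dl * f a by exact: mulr_gt0.
  rewrite (normrM (dl * f a)) (gtr0_norm dfa).
  have h1 := ler_wpM2l (ltW dfa) AB.
  have w0 : 0 <= dl * f a * dl ^+ 2 * A.
    exact: mulr_ge0 (mulr_ge0 (ltW dfa) (ltW q0)) (ltW A0).
  have h2 := ler_wpM2l w0 c2.
  have w1 : 0 <= dl * f a * dl ^+ 2 * ((1 + a ^+ 4) * (1 + c ^+ 4)) * B.
    by apply: mulr_ge0 (ltW B0); apply: mulr_ge0 P0; exact: mulr_ge0 (ltW dfa) (ltW q0).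
  move: cell; rewrite fcE; lra.
apply: le_trans s1 _; rewrite ler_pM2l; last exact: mulr_gt0.
have e1 : expR (a ^+ 2 / 2 - c ^+ 2 / 4) =
    expR (a ^+ 2 / 2) * expR (- (c ^+ 2 / 4)) by rewrite expRD.
have AB7 : A + B <= 7 * (expR (a ^+ 2 / 2) * expR (- (c ^+ 2 / 4))).
  rewrite -e1; lra.
have qa := quartic_le_gauss a.
have qc := quartic_gauss_le c.
have ea0 := expR_gt0 (a ^+ 2 / 2).
have ec0 := expR_gt0 (- (c ^+ 2 / 4)).
have eaE : expR (a ^+ 2) = expR (a ^+ 2 / 2) * expR (a ^+ 2 / 2).
  by rewrite -expRD; congr expR; lra.
have s2 : (1 + a ^+ 4) * (1 + c ^+ 4) * (A + B) <=
    7 * ((8 * expR (a ^+ 2 / 2)) * (1152 / (1 + c ^+ 2)) * expR (a ^+ 2 / 2)).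
  apply: (@le_trans _ _ ((1 + a ^+ 4) * (1 + c ^+ 4) *
     (7 * (expR (a ^+ 2 / 2) * expR (- (c ^+ 2 / 4)))))).
    exact: ler_wpM2l.
  rewrite (_ : _ * (7 * _) = 7 * ((1 + a ^+ 4) *
     ((1 + c ^+ 4) * expR (- (c ^+ 2 / 4))) * expR (a ^+ 2 / 2))); last by ring.
  rewrite ler_pM2l // ler_pM2r //.
  apply: ler_pM => //; first lra.
  by apply: mulr_ge0; [lra|exact: ltW].
have := ler_wpM2l (ltW q0) s2; rewrite eaE; lra.
Qed.

Lemma integral_cells (f : R -> R) dl n : 0 < dl ->
  leb.-integrable setT (EFin \o f) ->
  \int[leb]_(x in `]-oo, (grid dl n + dl / 2)%R]) f x =
  \int[leb]_(x in `]-oo, (grid dl 0 + dl / 2)%R]) f x +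
  \sum_(1 <= k < n.+1)
    \int[leb]_(x in `[grid dl k - dl / 2, grid dl k + dl / 2]) f x.
Proof.
move=> dl0 fi; elim: n => [|n IH]; first by rewrite big_geq // addr0.
rewrite big_nat_recr //= addrA -IH.
have -> : grid dl n + dl / 2 = grid dl n.+1 - dl / 2 by rewrite gridS; lra.
apply: Rintegral_itv_cat => //; first by lra.
by apply: integrableS fi.
Qed.

(** The discrete Mills ratio [\sum_(k < n) mass_ratio dl n k] and the Mills
    ratio of the diffusion, measured in steps of the grid, differ by one half up
    to an error of order [dl].  The half is the part of the cell of [n] that
    lies to the left of [n]. *)
Lemma mills_ratio_error dl mu n : 0 < dl -> 0 < mu -> (0 < n)%N ->
  1 < dl ^+ 2 * n%:R -> dl ^+ 2 * n%:R <= 2 ->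
  let a := grid dl n in let f := density dl a mu in
  leb.-integrable setT (EFin \o f) ->
  `|\int[leb]_(x in `]-oo, a]) f x / (dl * f a) -
    (\sum_(0 <= k < n) mass_ratio dl n k + 1 / 2)| <=
  (28 * 7 * 8 * 1152 * 12 + 200) * dl * (1 + a) * expR (a ^+ 2).
Proof.
move=> dl0 mu0 n0 n1 n2; lazy zeta.
have dl2 : dl ^+ 2 <= 2.
  apply: le_trans n2; apply: ler_peMr; first exact: sqr_ge0.
  by rewrite ler1n.
have dl3 : dl <= 3 / 2 by nra.
have da : dl * grid dl n = dl ^+ 2 * n%:R - 1 by rewrite mul_grid.
have a0 : 0 < grid dl n by rewrite -(pmulr_rgt0 _ dl0) da; lra.
have da1 : dl * grid dl n <= 1 by lra.
have half := integral_half_cell dl0 dl2 mu0 n0 a0.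
have left := integral_left_tail dl0 dl2 mu0 n0 a0 da1.
have cellE k : (1 <= k < n)%N -> _ := @cell_mass_error dl mu n k dl0 dl2 mu0 a0 da1.
have mass0 := mass_ratio_gauss dl0 dl2 a0 da1 (leq0n n).
have B0 := mass_ratio_gt0 n 0 dl0.
move: half left cellE mass0; lazy zeta.
set a := grid dl n in a0 da da1 *; set f := density dl a mu.
move=> half left cellE mass0 fi; have {}left := left fi.
have fa : 0 < f a by exact: density_gt0.
have dfa : 0 < dl * f a by exact: mulr_gt0.
have T0 : 0 <= \int[leb]_(x in `]-oo, (grid dl 0 + dl / 2)%R]) f x.
  by apply: Rintegral_ge0 => x _; apply: ltW; exact: density_gt0.
have IE : \int[leb]_(x in `]-oo, a]) f x =
    \int[leb]_(x in `]-oo, (grid dl 0 + dl / 2)%R]) f x +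
    \sum_(1 <= k < n)
      \int[leb]_(x in `[grid dl k - dl / 2, grid dl k + dl / 2]) f x +
    \int[leb]_(x in `[a - dl / 2, a]) f x.
  rewrite (@Rintegral_itv_cat _ f _ (a - dl / 2)) //; first last.
  - exact: integrableS fi.
  - by rewrite gerBl divr_ge0 // ltW.
  have aE : a = grid dl n.-1 + dl by rewrite -gridS prednK.
  have -> : a - dl / 2 = grid dl n.-1 + dl / 2 by rewrite aE; field.
  by rewrite (integral_cells n.-1 dl0 fi) prednK.
set I := \int[leb]_(x in `]-oo, a]) f x in IE *.
set T := \int[leb]_(x in `]-oo, (grid dl 0 + dl / 2)%R]) f x in left T0 IE.
set H := \int[leb]_(x in `[a - dl / 2, a]) f x in half IE.
set E := expR (a ^+ 2) in left cellE *.
have E0 : 0 < E by exact: expR_gt0.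
have E1 : 1 <= E by rewrite -expR0 ler_expR sqr_ge0.
pose q : R := 28 * 7 * 8 * 1152.
have sumE : `|\sum_(1 <= k < n)
      \int[leb]_(x in `[grid dl k - dl / 2, grid dl k + dl / 2]) f x -
     dl * f a * \sum_(1 <= k < n) mass_ratio dl n k| <=
     dl * f a * (q * 12 * dl * E).
  rewrite mulr_sumr -sumrB.
  apply: le_trans (ler_norm_sum _ _ _) _.
  apply: (@le_trans _ _ (\sum_(1 <= k < n)
      dl * f a * (q * dl ^+ 2 * E * (1 + grid dl k ^+ 2)^-1))).
    by rewrite big_nat_cond [leRHS]big_nat_cond; apply: ler_sum => k /andP[/cellE].
  rewrite -mulr_sumr ler_pM2l // -mulr_sumr.
  have := sum_grid_reciprocal dl0 dl2 n0.
  set s := \sum_(_ <= k < _) _ => hs.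
  have qE : 0 <= q * dl ^+ 2 * E.
    apply: mulr_ge0 (ltW E0); apply: mulr_ge0 (sqr_ge0 _); rewrite /q; lra.
  apply: le_trans (ler_wpM2l qE hs) _.
  by rewrite le_eqVlt; apply/orP; left; apply/eqP; field; rewrite gt_eqF.
have mass0' : mass_ratio dl n 0 <= 32 * dl * E.
  apply: le_trans mass0 _.
  have x0E : grid dl 0 = - dl^-1 by rewrite /grid mulr0 sub0r.
  rewrite x0E sqrrN expRD.
  have small := expRN_inv_sqr_le dl0.
  have ee : expR (a ^+ 2 / 2) <= E by rewrite ler_expR; have := sqr_ge0 a; lra.
  have p1 : expR (a ^+ 2 / 2) * expR (- (dl^-1 ^+ 2 / 4)) <= E * (4 * dl ^+ 2).
    by apply: ler_pM => //; exact: expR_ge0.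
  have p2 : E * dl ^+ 2 <= E * (2 * dl) by rewrite ler_pM2l //; nra.
  lra.
have SE : \sum_(0 <= k < n) mass_ratio dl n k =
    mass_ratio dl n 0 + \sum_(1 <= k < n) mass_ratio dl n k by rewrite big_ltn.
rewrite SE; move: sumE IE; rewrite -/q.
set S1 := \sum_(1 <= k < n) mass_ratio dl n k.
set J := \sum_(1 <= k < n) _ => sumE IE.
have -> : I / (dl * f a) - (mass_ratio dl n 0 + S1 + 1 / 2) =
    (dl * f a)^-1 * (T + (J - dl * f a * S1) + (H - dl / 2 * f a) -
                    dl * f a * mass_ratio dl n 0).
  by rewrite IE; field; rewrite !gt_eqF.
rewrite normrM gtr0_norm ?invr_gt0 // mulrC ler_pdivrMr //.
have D0 : 0 < dl * f a * dl by rewrite mulr_gt0.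
have h1 := ler_wpM2l (ltW D0) E1.
have h2 : 0 <= dl * f a * dl * a by exact: mulr_ge0 (ltW D0) (ltW a0).
have h3 := ler_wpM2l h2 E1.
have h4 : 0 <= dl * f a * dl * a * E by apply: mulr_ge0 => //; exact: ltW.
have h5 := ler_wpM2l (ltW dfa) mass0'.
have h6 : 0 <= dl * f a * mass_ratio dl n 0 by exact: mulr_ge0 (ltW dfa) (ltW B0).
have q0 : 0 <= q by rewrite /q; lra.
have h7 := mulr_ge0 q0 h4.
move: sumE half; rewrite !ler_norml => /andP[s1 s2] /andP[t1 t2].
by apply/andP; split; lra.
Qed.

End MillsComparison.


(** * From Mills ratios to tails *)

Section TailRatio.
Context {R : realType}.
Implicit Types (dl a u S J E C v : R) (i n : nat).

(** Replacing [J] by [S + 1 / 2] turns the left-hand quotient into exactly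
    [1 + u / (2 + u)]. *)
Lemma quotient_error u S J E : 0 < u -> 0 <= S -> `|J - (S + 1 / 2)| <= E ->
  `|(1 + 2 * u / (2 + u) * J) / (1 + u / (1 + u) * S) - 1| <= u / 2 + u * E.
Proof.
move=> u0 S0 hJ.
have E0 : 0 <= E := le_trans (normr_ge0 _) hJ.
set D := 1 + u / (1 + u) * S.
have D1 : 1 <= D.
  by rewrite /D lerDl mulr_ge0 // divr_ge0 //; lra.
have -> : (1 + 2 * u / (2 + u) * J) / D - 1 =
    u / (2 + u) + 2 / (2 + u) / D * (u * (J - (S + 1 / 2))).
  have uS : 0 <= u * S by rewrite mulr_ge0 // ltW.
  by rewrite /D; field; rewrite !gt_eqF //=; lra.
apply: le_trans (ler_normD _ _) _; apply: lerD.
  rewrite ger0_norm; last by rewrite divr_ge0 //; lra.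
  by rewrite ler_pM2l // lef_pV2 ?posrE; lra.
rewrite normrM; apply: (@le_trans _ _ (1 * (u * E))); last by rewrite mul1r.
apply: ler_pM => //.
  rewrite ger0_norm; last by rewrite !divr_ge0 //; lra.
  rewrite ler_pdivrMr; last lra.
  by rewrite mul1r ler_pdivrMr; nra.
by rewrite normrM (gtr0_norm u0) ler_pM2l.
Qed.

(** With [y = u / (2 + u)], the rate of the geometric tail is
    [ln ((1 + y) / (1 - y))], and the rate [2 * y] of the exponential tail is the
    leading term of its expansion. *)
Lemma rate_defect u : 0 < u -> u <= 1 ->
  0 <= ln (1 + u) - 2 * u / (2 + u) <= u ^+ 3.
Proof.
move=> u0 u1.
have hu : 1 <= 1 + u <= 3 by apply/andP; split; lra.
have := ln_ge1_bounds hu.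
have -> : (1 + u - 1) / (1 + u + 1) = u / (2 + u) by congr (_ / _); lra.
rewrite mulrA => /andP[h1 h2].
have h3 : (u / (2 + u)) ^+ 3 <= (u / 2) ^+ 3.
  have p1 : 0 <= u / (2 + u) by rewrite divr_ge0 //; lra.
  have p2 : u / (2 + u) <= u / 2 by rewrite ler_pM2l // lef_pV2 ?posrE; lra.
  by rewrite lerXn2r ?nnegrE //; lra.
have u3 := exprn_ge0 3 (ltW u0).
by apply/andP; split; lra.
Qed.

(** The rate defect accumulates to some [v] over [i] steps, and
    [1 - expR (- v)] is at most [v] and at most [1].  The first bound is used
    when the minimum is [Num.max z 1]; the second when it is the other entry,
    which is large enough for the whole term to exceed [1]. *)
Lemma tail_ratio_bound dl a S J C i : 0 < dl -> 0 < a -> dl * a <= 1 ->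
  0 <= S -> 0 <= J -> 1 <= C ->
  `|J - (S + 1 / 2)| <= C * dl * (1 + a) * expR (a ^+ 2) ->
  let u := dl * a in
  let err := dl ^+ 2 + dl * u + u ^+ 2 in
  let z := a + dl * i%:R in
  `|(((1 + u)^-1 ^+ i) / (1 + u / (1 + u) * S)) /
    (expR (- (2 * u / (2 + u)) * i%:R) / (1 + 2 * u / (2 + u) * J)) - 1| <=
  u + C * expR (a ^+ 2) * err + C * expR (2 * a ^+ 2) * a ^+ 2 * err *
    Num.min (Num.max z 1) (1 / dl ^+ 2 * (1 / a + dl) ^+ 3).
Proof.
move=> dl0 a0 da1 S0 J0 C1 hJ; lazy zeta.
set u := dl * a; set err := dl ^+ 2 + dl * u + u ^+ 2.
set z := a + dl * i%:R.
have u0 : 0 < u by exact: mulr_gt0.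
have A1 := quotient_error u0 S0 hJ.
set A := (_ / _) in A1.
have /andP[r1 r2] := rate_defect u0 da1.
set e := ln (1 + u) - _ in r1 r2.
pose v := i%:R * e.
have v0 : 0 <= v by rewrite mulr_ge0.
have -> : (((1 + u)^-1 ^+ i) / (1 + u / (1 + u) * S)) /
    (expR (- (2 * u / (2 + u)) * i%:R) / (1 + 2 * u / (2 + u) * J)) =
    A * expR (- v).
  have -> : (1 + u)^-1 ^+ i =
      expR (- v) * expR (- (2 * u / (2 + u)) * i%:R).
    rewrite -expRD /v /e.
    have -> : - (i%:R * (ln (1 + u) - 2 * u / (2 + u))) +
        - (2 * u / (2 + u)) * i%:R = i%:R * (- ln (1 + u)) by ring.
    by rewrite expRM_natl expRN lnK // posrE; lra.
  have d1 : 0 < 1 + u / (1 + u) * S.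
    by rewrite ltr_pwDl // mulr_ge0 // divr_ge0 //; lra.
  have d2 : 0 < 1 + 2 * u / (2 + u) * J.
    by rewrite ltr_pwDl // mulr_ge0 // divr_ge0 //; lra.
  rewrite /A; move: d1 d2.
  set D1 := 1 + _; set D2 := 1 + 2 * u / _ * _ => d1 d2.
  by field; rewrite expR_eq0 !gt_eqF.
have ev1 : expR (- v) <= 1 by rewrite -expR0 ler_expR oppr_le0.
have ev0 := expR_gt0 (- v).
have step : `|A * expR (- v) - 1| <= `|A - 1| + (1 - expR (- v)).
  have -> : A * expR (- v) - 1 = (A - 1) * expR (- v) - (1 - expR (- v)) by ring.
  apply: le_trans (ler_normB _ _) _; apply: lerD.
    by rewrite normrM (gtr0_norm ev0) ler_piMr.
  by rewrite ger0_norm //; lra.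
apply: le_trans step _.
have ea0 := expR_gt0 (a ^+ 2).
have main : `|A - 1| <= u + C * expR (a ^+ 2) * err.
  apply: le_trans A1 _; apply: lerD; first lra.
  have -> : u * (C * dl * (1 + a) * expR (a ^+ 2)) =
     C * expR (a ^+ 2) * (dl * u + u ^+ 2) by rewrite /u; ring.
  apply: ler_wpM2l; first by apply: mulr_ge0; lra.
  by rewrite /err; have := sqr_ge0 dl; lra.
apply: lerD => //.
have err0 : dl ^+ 2 * a <= err.
  by rewrite /err /u; have := sqr_ge0 dl; have := sqr_ge0 (dl * a); lra.
have dl2 : 0 < dl ^+ 2 by rewrite exprn_gt0.
have a2 : 0 < a ^+ 2 by rewrite exprn_gt0.
have K1 : a ^+ 2 * err <= C * expR (2 * a ^+ 2) * a ^+ 2 * err.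
  have ce : 1 <= C * expR (2 * a ^+ 2).
    rewrite -[leLHS]mulr1; apply: ler_pM => //.
    by rewrite -expR0 ler_expR mulr_ge0 // ltW.
  rewrite -mulrA; apply: ler_peMl => //; apply: mulr_ge0 (ltW a2) _.
  by apply: le_trans err0; apply: mulr_ge0; exact: ltW.
have K0 : a ^+ 2 * (dl ^+ 2 * a) <= a ^+ 2 * err by rewrite ler_pM2l.
have z0 : 0 <= dl * i%:R by rewrite mulr_ge0 // ltW.
set K := C * expR (2 * a ^+ 2) * a ^+ 2 * err in K1 *.
have K2 : a ^+ 2 * (dl ^+ 2 * a) <= K by exact: le_trans K0 K1.
have p0 : 0 <= a ^+ 2 * (dl ^+ 2 * a).
  by rewrite mulr_ge0 ?(ltW a2) // mulr_ge0 // ltW.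
have [_|_] := leP (Num.max z 1) (1 / dl ^+ 2 * (1 / a + dl) ^+ 3).
  apply: le_trans (one_sub_expRN_le v) _.
  have v1 : v <= a ^+ 2 * (dl ^+ 2 * a) * (dl * i%:R).
    have := ler_wpM2l (ler0n R i) r2; rewrite /v /u; lra.
  apply: le_trans v1 _; apply: ler_pM => //.
  by rewrite le_max /z; apply/orP; left; lra.
apply: (@le_trans _ _ 1); first lra.
rewrite [leLHS](_ : _ = a ^+ 2 * (dl ^+ 2 * a) * (1 / dl ^+ 2 * (1 / a) ^+ 3));
  last by field; rewrite !gt_eqF.
have ia : 0 <= 1 / a by rewrite divr_ge0 // ltW.
apply: ler_pM => //.
  by rewrite mulr_ge0 ?exprn_ge0 // divr_ge0 // ltW.
apply: ler_wpM2l; first by rewrite divr_ge0 // ltW.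
by rewrite lerXn2r ?nnegrE //; lra.
Qed.

End TailRatio.

(** * The tail of the queue length *)

Section ErlangCTail.
Context {R : realType}.

(** Erlang's delay formula, extended to all levels above [n]. *)
Lemma erlangC_tail (lam mu : R) n (P : R -> R.-pker nat ~> nat)
    (m : probability nat R) : 0 < lam -> 0 < mu -> (0 < n)%N ->
  transition_function (erlangC_rate lam mu n) P ->
  stationary_distribution P m ->
  let rho := rho lam mu n in let dl := delta lam mu in
  forall i, rho < 1 ->
  tail m (n + i) =
  rho ^+ i / (1 + (1 - rho) * \sum_(0 <= k < n) mass_ratio dl n k).
Proof.
move=> lam0 mu0 n0 tf st rho dl i rho1.
pose p j := fine (m [set j]).
have n0R : 0 < n%:R :> R by rewrite ltr0n.
have dl2 : dl ^+ 2 = mu / lam.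
  rewrite /dl /delta exprVn sqr_sqrtr ?invf_div //.
  by rewrite /offered_load divr_ge0 // ltW.
have bal j : lam * p j = mu * (minn j.+1 n)%:R * p j.+1.
  apply: (@detailed_balance R (fun=> lam) (fun k => mu * (minn k n)%:R) P m
    (lam + mu * n%:R)) => //.
  - by rewrite min0n mulr0.
  - by move=> _; rewrite gtr0_norm // lerDl mulr_ge0 // ltW.
  - move=> k; rewrite ger0_norm ?mulr_ge0 ?(ltW mu0) //.
    apply: (@le_trans _ _ (mu * n%:R)); last by rewrite lerDr ltW.
    by rewrite ler_pM2l // ler_nat geq_minr.
have below k : (k <= n)%N -> p k = mass_ratio dl n k * p n.
  move: k; apply: down_ind; first by rewrite mass_ratio_nn mul1r.
  move=> k kn IH; rewrite (mass_ratioS _ kn) -mulrA -IH dl2.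
  have := bal k; rewrite (minn_idPl kn) => e.
  apply: (mulfI (lt0r_neq0 lam0)); rewrite e; field; exact: lt0r_neq0.
have above k : (n <= k)%N -> p k.+1 = rho * p k.
  move=> nk; have := bal k; rewrite (minn_idPr (leqW nk)) => e.
  have q0 : mu * n%:R != 0 by rewrite mulf_neq0 // gt_eqF.
  apply: (mulfI q0); rewrite -e /rho /Defs.rho; field.
  by rewrite !gt_eqF.
have powE k : p (n + k)%N = rho ^+ k * p n.
  elim: k => [|k IH]; first by rewrite addn0 mul1r.
  by rewrite addnS above ?leq_addr // IH exprS mulrA.
have geo := geometric_tail above.
have S0 : 0 <= \sum_(0 <= k < n) mass_ratio dl n k.
  apply: sumr_ge0 => k _; apply: prodr_ge0 => j _.
  by rewrite mulr_ge0 // exprn_even_ge0.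
have tot := tail_split m n.
rewrite big_nat_cond (eq_bigr (fun k => mass_ratio dl n k * p n)) in tot; last first.
  by move=> k /andP[/andP[_ kn] _]; apply: below; exact: ltnW.
rewrite -big_nat_cond -mulr_suml in tot.
move: S0 tot; set S := \sum_(_ <= _ < _) _ => S0 tot.
have tn : (1 - rho) * tail m n = p n by exact: geo.
have tk : (1 - rho) * tail m (n + i) = rho ^+ i * p n.
  by rewrite geo ?leq_addr // -powE.
have r0 : 0 < 1 - rho by lra.
have D0 : 0 < 1 + (1 - rho) * S by rewrite ltr_pwDl // mulr_ge0 // ltW.
have tnE : tail m n * (1 + (1 - rho) * S) = 1.
  by rewrite -[RHS]tot -tn; ring.
have -> : rho ^+ i / (1 + (1 - rho) * S) = rho ^+ i * tail m n.
  by rewrite -[in RHS](mulfK (lt0r_neq0 D0) (tail m n)) tnE mul1r.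
by apply: (mulfI (lt0r_neq0 r0)); rewrite tk -tn mulrCA.
Qed.

End ErlangCTail.


(** * The relative error of the tail *)

Theorem theorem4p1 (R : realType) :
  exists2 C : R, 0 < C &
  forall (lam mu : R) (n : nat),
    0 < lam -> 0 < mu -> (1 <= n)%N ->
    1 / 2 <= rho lam mu n -> rho lam mu n < 1 ->
  forall (P : R -> R.-pker nat ~> nat),
    transition_function (erlangC_rate lam mu n) P ->
  forall (d : measure_display) (T : measurableType d) (Pr : probability T R)
         (X : {RV Pr >-> nat}),
    stationary_distribution P (distribution Pr X) ->
  forall (d' : measure_display) (T' : measurableType d')
         (Pr' : probability T' R) (Y : {RV Pr' >-> R}),
    has_density (distribution Pr' Y) (YS_density lam mu n) ->
  forall k : nat, (n < k)%N ->
  let rho := rho lam mu n in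
  let delta := delta lam mu in
  let zeta := zeta lam mu n in
  let z := delta * (k%:R - offered_load lam mu) in
  let err := delta ^+ 2 + delta * ((1 - rho) / rho)
             + (1 - rho) ^+ 2 / rho ^+ 2 in
  `| fine (Pr [set w | z <= scaled_count lam mu (X w)])
     / fine (Pr' [set w | z <= Y w]) - 1 |
  <= (1 - rho) / rho + 2 * (1 - rho) ^+ 2 / rho + delta ^+ 2
     + C * expR (zeta ^+ 2) * err
     + C * expR (2 * zeta ^+ 2) * zeta ^+ 2 * err
       * Num.min (Num.max z 1)
                 (1 / delta ^+ 2 * (1 / `|zeta| + delta) ^+ 3).
Proof.
pose C0 : R := 28 * 7 * 8 * 1152 * 12 + 200.
exists C0; first by rewrite /C0; lra.
move=> lam mu n lam0 mu0 n1 rho1 rho2 P tf d T Pr X st d' T' Pr' Y hd k nk.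
lazy zeta.
set dl := delta lam mu; set z := dl * (k%:R - offered_load lam mu).
set r := offered_load lam mu in z *.
have n0R : 0 < n%:R :> R by rewrite ltr0n.
have r0 : 0 < r by rewrite divr_gt0.
have dl0 : 0 < dl by rewrite /dl /delta invr_gt0 sqrtr_gt0.
have dlr : dl ^+ 2 * r = 1.
  by rewrite /dl /delta exprVn sqr_sqrtr ?ltW // mulVf // gt_eqF.
have rhoE : rho lam mu n = r / n%:R.
  by rewrite /rho /r /offered_load invfM mulrCA mulrC.
have rn : r < n%:R by move: rho2; rewrite rhoE ltr_pdivrMr // mul1r.
have nr : n%:R <= 2 * r by move: rho1; rewrite rhoE ler_pdivlMr //; lra.
have dln1 : 1 < dl ^+ 2 * n%:R by rewrite -[ltLHS]dlr ltr_pM2l ?exprn_gt0.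
have dln2 : dl ^+ 2 * n%:R <= 2.
  have -> : 2 = dl ^+ 2 * (2 * r) by rewrite mulrCA dlr mulr1.
  by rewrite ler_pM2l ?exprn_gt0.
have dlV : dl^-1 = dl * r.
  by apply: (mulfI (lt0r_neq0 dl0)); rewrite divff ?gt_eqF // mulrA -expr2 dlr.
have aE : - zeta lam mu n = grid dl n.
  by rewrite /zeta -/dl -/r /grid dlV; ring.
have da : dl * grid dl n = dl ^+ 2 * n%:R - 1 by rewrite mul_grid.
have a0 : 0 < grid dl n by rewrite -(pmulr_rgt0 _ dl0) da; lra.
have da1 : dl * grid dl n <= 1 by lra.
have z0 : zeta lam mu n < 0 by rewrite -oppr_gt0 aE.
have u1E : 1 + dl * grid dl n = dl ^+ 2 * n%:R by rewrite da; ring.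
have rhoV : rho lam mu n = (1 + dl * grid dl n)^-1.
  rewrite u1E rhoE.
  have -> : r = (dl ^+ 2)^-1.
    have q0 : dl ^+ 2 != 0 by rewrite expf_neq0 // gt_eqF.
    by apply: (mulfI q0); rewrite dlr divff.
  by rewrite -invfM.
pose i := (k - n)%N.
have kE : k = (n + i)%N by rewrite subnKC // ltnW.
have zE : z = grid dl n + dl * i%:R.
  by rewrite /z kE natrD /grid dlV; ring.
have PX : fine (Pr [set w | z <= scaled_count lam mu (X w)]) =
    tail (distribution Pr X) (n + i).
  rewrite /tail /distribution /pushforward -kE; congr (fine (Pr _)).
  apply/seteqP; split => w /=; rewrite /scaled_count -/dl -/r /z ler_pM2l //;
    by rewrite lerD2r ler_nat.
rewrite PX (erlangC_tail lam0 mu0 n1 tf st i rho2).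
have [fi YE] := YS_tail dl0 z0 mu0 hd.
have PY : fine (Pr' [set w | z <= Y w]) =
    fine (distribution Pr' Y [set` `[z, +oo[%R]).
  rewrite /distribution /pushforward; congr (fine (Pr' _)).
  by apply/seteqP; split => w /=; rewrite in_itv /= andbT.
rewrite PY YE; last by rewrite aE zE lerDl mulr_ge0 // ltW.
rewrite -/dl aE in fi *.
set I := Rintegral _ _ _.
set fa := density dl (grid dl n) mu (grid dl n).
set S := \sum_(0 <= _ < _) _.
have fa0 : 0 < fa by exact: density_gt0.
have I0 : 0 <= I.
  by apply: Rintegral_ge0 => x _; apply: ltW; exact: density_gt0.
have S0 : 0 <= S by apply: sumr_ge0 => j _; exact/ltW/mass_ratio_gt0.
pose J := I / (dl * fa).
have J0 : 0 <= J by rewrite divr_ge0 // ltW // mulr_gt0.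
have hJ := mills_ratio_error dl0 mu0 n1 dln1 dln2 fi.
have C1 : 1 <= C0 by rewrite /C0; lra.
have := tail_ratio_bound i dl0 a0 da1 S0 J0 C1 hJ; lazy zeta.
rewrite -zE.
have zetaE : zeta lam mu n = - grid dl n by rewrite -aE opprK.
rewrite zetaE normrN (gtr0_norm a0) sqrrN rhoV.
set u := dl * grid dl n in da1 u1E *; set a := grid dl n.
have u0 : 0 < u by exact: mulr_gt0.
have uE : u = dl * a by [].
have e1 : (1 - (1 + u)^-1) / (1 + u)^-1 = u.
  by field; rewrite gt_eqF //; lra.
have e2 : (1 - (1 + u)^-1) ^+ 2 / (1 + u)^-1 ^+ 2 = u ^+ 2.
  by rewrite -[RHS](congr1 (fun x => x ^+ 2) e1) expr_div_n.
have e3 : 1 - (1 + u)^-1 = u / (1 + u) by field; rewrite gt_eqF //; lra.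
have e4 : decay dl a * (I / fa) = 2 * u / (2 + u) * J.
  rewrite /decay /J uE; clearbody I fa; field.
  by rewrite !gt_eqF //= -uE; lra.
have e5 : - decay dl a * (z - a) = - (2 * u / (2 + u)) * i%:R.
  rewrite zE /decay -/a uE; field.
  by rewrite gt_eqF //= -uE; lra.
have e6 : 0 <= 2 * (1 - (1 + u)^-1) ^+ 2 / (1 + u)^-1.
  by rewrite divr_ge0 ?invr_ge0 ?mulr_ge0 ?sqr_ge0 //; lra.
rewrite e1 e2 e3 in e6 *; rewrite e4 e5.
have := sqr_ge0 dl.
set L := `|_ - 1|; set m := Num.min _ _.
lra.
Qed.
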